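(* Let $\lambda,\mu$ be partitions of a positive integer $n$, and let $\mu^{[1]}=(\mu_2,\mu_3,\ldots)$. Then $$X^\lambda_\mu(t)=\sum_{j=1}^{l(\lambda)}\ \sum_{\underline i,\underline a}C(S_{\underline i,\underline a})\;X^{S_{i_1,a_1}S_{i_2,a_2}\cdots S_{i_r,a_r}(\lambda-\mu_1\varepsilon_j)}_{\mu^{[1]}}(t),$$ where $\varepsilon_j\in\mathbb Z^{l(\lambda)}$ has $1$ in position $j$ and $0$ elsewhere, and for each $j$ the inner sum runs over all $\underline i=(i_1,\ldots,i_r)$, $\underline a=(a_1,\ldots,a_r)\in\mathbb Z_+^r$ (of any length $r\ge0$, with $\mathbb Z_+$ the nonnegative integers) such that $S_{i_1,a_1}S_{i_2,a_2}\cdots S_{i_r,a_r}(\lambda-\mu_1\varepsilon_j)$ is a partition of $n-\mu_1$.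
   Context: Green polynomials: Let $V$ be the ring of symmetric functions over $\mathbb Q(t)$, with power sums $p_n$, $p_\lambda=p_{\lambda_1}p_{\lambda_2}\cdots$. For a partition $\lambda$ with $m_i(\lambda)$ parts equal to $i$, put $z_\lambda=\prod_{i\ge1}i^{m_i(\lambda)}m_i(\lambda)!$ and $z_\lambda(t)=z_\lambda/\prod_{i=1}^{l(\lambda)}(1-t^{\lambda_i})$, where $l(\lambda)$ is the number of nonzero parts. Equip $V$ with the bilinear form $\langle p_\lambda,p_\mu\rangle=\delta_{\lambda\mu}z_\lambda(t)$. Define $q_n\in V$ by $\sum_{n\ge0}q_nz^n=\exp\left(\sum_{n\ge1}\frac{1-t^n}{n}p_nz^n\right)$. The Hall-Littlewood functions are $Q_\lambda(t)=\prod_{i<j}\frac{1-R_{ij}}{1-tR_{ij}}\,q_{\lambda_1}\cdots q_{\lambda_l}$, where the raising operator $R_{ij}$ raises the $i$-th index by 1 and lowers the $j$-th index by 1, and $P_\lambda(t)=b_\lambda(t)^{-1}Q_\lambda(t)$ with $b_\lambda(t)=\prod_{i\ge1}\prod_{j=1}^{m_i(\lambda)}(1-t^j)$. The Green polynomials $X^\lambda_\mu(t)$ are defined by $p_\mu=\sum_\lambda X^\lambda_\mu(t)P_\lambda(t)$; equivalently $X^\lambda_\mu(t)=\langle Q_\lambda(t),p_\mu\rangle$. In particular $X^\emptyset_\emptyset=1$. Straightening: For an integer tuple $\alpha=(\alpha_1,\ldots,\alpha_l)$ and an index $i$ with $\alpha_i<\alpha_{i+1}$ put $d=\alpha_{i+1}-\alpha_i$.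 For $0\le a\le\lfloor d/2\rfloor$ let $S_{i,a}\alpha=(\alpha_1,\ldots,\alpha_{i-1},\alpha_{i+1}-a,\alpha_i+a,\alpha_{i+2},\ldots,\alpha_l)$, with attached coefficient (relative to $\alpha$) $$C(S_{i,a})=\begin{cases}t& a=0,\\ t^{a+1}-t^{a-1}&1\le a<\lfloor d/2\rfloor,\\ t^{a+\epsilon}-t^{a-1}& a=\lfloor d/2\rfloor\ge1,\end{cases}$$ where $\epsilon\in\{0,1\}$ is the parity of $d$. For $\underline i=(i_1,\ldots,i_r)$ and $\underline a=(a_1,\ldots,a_r)$, the operations in $S_{i_1,a_1}\cdots S_{i_r,a_r}\alpha$ are applied successively from right to left, each being defined on the tuple to which it is applied, and $C(S_{\underline i,\underline a})=C(S_{i_1,a_1})\cdots C(S_{i_r,a_r})$, each factor computed relative to the tuple to which the operation is applied (the empty sequence, $r=0$, has coefficient 1). A tuple is regarded as a partition if it is weakly decreasing with nonnegative entries; trailing zeros are ignored.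
   Formalization: The inner sum is taken only over sequences whose each operation acts at the index i chosen by a fixed, arbitrary rule for each tuple with ascents; over all sequences different orders are counted repeatedly and the formula fails, e.g. for λ=(1,1,1,1), μ=(2,2). *)

(* Defs.v *)
From mathcomp Require Import all_boot all_order all_algebra.
From mathcomp Require Import finmap.
From mathcomp Require Import boolp classical_sets fsbigop.
From mathcomp Require Import monalg.

Set Implicit Arguments.
Unset Strict Implicit.
Unset Printing Implicit Defensive.

Import GRing.Theory Num.Theory.

Local Open Scope classical_set_scope.
Local Open Scope ring_scope.

Definition Qt : fieldType := {fraction {poly rat}}.
Definition t : Qt := tofrac 'X.

(* Partitions are weakly decreasing lists of positive integers, so [size] is
   l(lambda) and [sumn] is |lambda|. *)
Definition is_partition (la : seq nat) : bool := sorted geq la && (0%N \notin la).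
Definition is_partition_of (n : nat) (la : seq nat) : bool :=
  is_partition la && (sumn la == n).

(* Symmetric functions over Q(t), as the polynomial ring Q(t)[p_1, p_2, ...]:
   over a field of characteristic 0 the power sums are algebraically
   independent generators. The variable of index k is p_(k+1). *)
Definition V : comAlgType Qt := {malg Qt[{cmonom nat}]}.
Definition psum (n : nat) : V := mkmalgU (ucm n.-1) 1.
Definition psum_part (la : seq nat) : V := \prod_(k <- la) psum k.

(* The coefficient of z^n in exp(sum_k (1 - t^k)/k p_k z^k). The exponent has
   no constant term in z, so that truncating it after z^n, and the exponential
   series after its n-th term, does not change this coefficient. *)
Definition qexponent (n : nat) : {poly V} :=
  \sum_(1 <= k < n.+1) (((1 - t ^+ k) / k%:R) *: psum k)%:P * 'X^k.
Definition qsym (n : nat) : V :=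
  \sum_(k < n.+1) (k`!%:R : Qt)^-1 *: (qexponent n ^+ k)`_n.

(* q_m = 0 for m < 0 *)
Definition qint (m : int) : V := if m is Posz n then qsym n else 0.

(* The coefficient of R^k in (1 - R) / (1 - t R) = (1 - R) * sum_k t^k R^k. *)
Definition raising_coef (k : nat) : Qt :=
  t ^+ k - (if k is k'.+1 then t ^+ k' else 0).

(* [k i j] is the exponent of R_ij; these exponents vanish unless i < j. *)
Definition raising_exponents (l : nat) : set 'M[nat]_l :=
  [set k : 'M[nat]_l | forall i j : 'I_l, (j <= i)%N -> k i j = 0%N].

(* Raising operators act on the indices, before q_m is set to 0 for m < 0.
   Only finitely many k contribute a nonzero term. *)
Definition HLQ (la : seq nat) : V :=
  \sum_(k \in @raising_exponents (size la))
    (\prod_(i < size la) \prod_(j < size la | (i < j)%N) raising_coef (k i j)) *: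
    \prod_(i < size la)
      qint ((nth 0%N la i)%:Z + \sum_(j < size la) (k i j)%:Z
                              - \sum_(j < size la) (k j i)%:Z).

Definition HLb (la : seq nat) : Qt :=
  \prod_(i <- undup la) \prod_(1 <= j < (count_mem i la).+1) (1 - t ^+ j).
Definition HLP (la : seq nat) : V := (HLb la)^-1 *: HLQ la.

(* The family [X la mu] is that of the Green polynomials: the coordinates of
   the p_mu in the basis of the P_la. A sum [\sum_(la \in A) _] with infinitely
   many nonzero terms is 0 by convention, while p_mu <> 0, so the equation
   forces each expansion to be finite. *)
Definition is_green (X : seq nat -> seq nat -> Qt) : Prop :=
  forall mu, is_partition mu ->
    psum_part mu = \sum_(la \in [set la | is_partition la]) X la mu *: HLP la.

(* Positions in tuples are counted from 0. *)
Definition ascent (al : seq int) (i : nat) : bool :=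
  (i.+1 < size al)%N && (al`_i < al`_i.+1).
Definition weakly_decreasing (al : seq int) : bool :=
  sorted (fun x y => y <= x) al.

Definition gap (al : seq int) (i : nat) : nat := absz (al`_i.+1 - al`_i)%R.

Definition Sop (ia : nat * nat) (al : seq int) : seq int :=
  let: (i, a) := ia in
  set_nth 0 (set_nth 0 al i (al`_i.+1 - a%:Z)) i.+1 (al`_i + a%:Z).
Definition Sop_defined (ia : nat * nat) (al : seq int) : bool :=
  ascent al ia.1 && (ia.2 <= (gap al ia.1)./2)%N.
Definition Sop_coef (ia : nat * nat) (al : seq int) : Qt :=
  let: (i, a) := ia in
  let d := gap al i in
  if a == 0%N then t
  else if (a < d./2)%N then t ^+ a.+1 - t ^+ a.-1
  else t ^+ (a + odd d) - t ^+ a.-1.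

(* [:: (i_1, a_1); ...; (i_r, a_r)] stands for S_{i_1,a_1} ... S_{i_r,a_r}: the
   last operation of the list is applied first. *)
Definition Sseq (s : seq (nat * nat)) (al : seq int) : seq int := foldr Sop al s.
Fixpoint Sseq_coef (s : seq (nat * nat)) (al : seq int) : Qt :=
  if s is ia :: s' then Sop_coef ia (Sseq s' al) * Sseq_coef s' al else 1.

(* A tuple may have several ascents. A straightening rule [sel] picks the
   ascent at which the next operation is performed. Without such a rule, one
   expansion of a tuple would be counted once for each order in which its
   ascents can be resolved: from (-1,1,1,1), which is (1,1,1,1) - 2 eps_1, one
   reaches (0,1,0,1), where exchanging entries 1 and 2 and exchanging entries
   3 and 4, in either order, give (1,0,1,0). *)
Definition straightening_rule (sel : seq int -> nat) : Prop :=
  forall al, ~~ weakly_decreasing al -> ascent al (sel al).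
Fixpoint Sseq_follows (sel : seq int -> nat) (s : seq (nat * nat))
    (al : seq int) : bool :=
  if s is ia :: s' then
    [&& Sseq_follows sel s' al, Sop_defined ia (Sseq s' al)
      & ia.1 == sel (Sseq s' al)]
  else true.

(* Dropping the trailing zeros of a partition tuple. *)
Definition parts_of (al : seq int) : seq nat :=
  [seq absz x | x <- al & x != 0].
Definition tuple_partition_of (m : int) (al : seq int) : bool :=
  [&& weakly_decreasing al, all (fun x => 0 <= x) al & \sum_(x <- al) x == m].

(* lambda - m eps_j *)
Definition sub_eps (la : seq nat) (m j : nat) : seq int :=
  [seq (nth 0%N la i)%:Z - (if i == j then m%:Z else 0) | i <- iota 0 (size la)].

(* Main.v *)
Require Import Defs.
From HB Require Import structures.
From mathcomp Require Import all_boot all_order all_algebra.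
From mathcomp Require Import finmap monalg.
From mathcomp Require Import boolp classical_sets fsbigop.
From mathcomp Require Import ring lra zify.

Set Implicit Arguments.
Unset Strict Implicit.
Unset Printing Implicit Defensive.

Import Order.TTheory GRing.Theory Num.Theory.

Local Open Scope classical_set_scope.
Local Open Scope ring_scope.

(** For an integer tuple [al], let Q_al be the Hall-Littlewood function given by
    the raising operators. Once the Q_la and P_la are known to be dual bases for
    the scalar product <p_la, p_mu> = delta z_la(t), the Green polynomial X^la_mu
    is <Q_la, p_mu>. Multiplication by p_m is adjoint to the derivation
    m / (1 - t^m) d/dp_m, which maps q_n to q_(n - m) and therefore Q_la to
    sum_j Q_(la - m eps_j) ([padj_HLtuple]). With m = mu_1 this is the recursion,
    except that the tuples la - m eps_j need not be partitions. A quadratic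
    relation expresses Q at an ascent (.., s, r, ..), s < r, through tuples of
    smaller weight sum_i i al_i ([HLtuple_straighten]); following a straightening
    rule down to weakly decreasing tuples yields one term for each sequence of
    operations ([straighten_list]). A weakly decreasing tuple that ends in a
    negative entry has Q = 0, since q_n = 0 for n < 0, and trailing zeros do not
    change Q; so exactly the partitions remain.

    All this, and the duality, is read off vertex operators instead of raising
    operators. Let f[p_k + s z^k] denote the effect of the substitution
    p_k -> p_k + s z^k, and define

      H_m f = sum_b q_(m + b) * (coefficient of z^b in f[p_k - z^k]).

    The substitution p_k -> p_k - z^k maps q_n to the sum of r_c z^c q_(n - c),
    where r_c is the coefficient of u^c in (1 - u) / (1 - t u). This is exactly
    the effect of the operators R_1j, so that Q_al = H_(al_1) ... H_(al_l) 1
    ([HLtuple_expand]). In these terms: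

    - H_s H_r f = sum_d r_d G(s + d, r - d) with G symmetric ([vertex2E]), because
      two substitutions commute. Multiplying by 1 - t u turns this into
      H_s H_r - t H_(s+1) H_(r-1) = G(s, r) - G(s + 1, r - 1), and the symmetry of
      G gives the relation used for straightening ([vertex_exchange]).

    - The adjoint of multiplication by q_a takes f to the coefficient of z^a in
      f[p_k + z^k] ([hall_q]). As the two substitutions are mutually inverse,
      the sum over b of H_(m + b) applied to the coefficient of z^b in
      f[p_k + z^k] is q_m f ([vertex_add_skew]). Hence the adjoint of q_a kills
      Q_mu for a > mu_1, and for a = mu_1 it removes the first part, up to the
      scalar 1 - t^(multiplicity of mu_1) ([skew_HLpart]).

    - If la_1 >= mu_1, only the term b = 0 of H_(la_1) survives in <Q_la, Q_mu>,
      and induction gives <Q_la, Q_mu> = delta b_la(t) ([hall_HLpart]).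

    The algebra of symmetric functions enters only through its generation by the
    p_k, the substitution homomorphisms, the Newton recursion for q_n and the
    scalar product. The argument is carried out over any algebra that has these. *)

(** * The exponential of a power series *)

Section Exponential.
Variables (F : fieldType) (V : comAlgType F).
Hypothesis natrF_neq0 : forall k, (0 < k)%N -> k%:R != 0 :> F.

Lemma coef_exp_eq (a b : {poly V}) n :
  (forall i, (i <= n)%N -> a`_i = b`_i) ->
  forall k i, (i <= n)%N -> (a ^+ k)`_i = (b ^+ k)`_i.
Proof.
move=> eqab; elim=> [|k IHk] i le_in; first by rewrite !expr0.
rewrite !exprS !coefM; apply: eq_bigr => j _.
by rewrite eqab ?IHk //; have := ltn_ord j; lia.
Qed.

Lemma coef_exp_eq0 (a : {poly V}) : a`_0 = 0 ->
  forall k i, (i < k)%N -> (a ^+ k)`_i = 0.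
Proof.
move=> a0; elim=> // k IHk i lt_ik.
rewrite exprS coefM big_ord_recl a0 mul0r add0r big1 // => j _.
by rewrite IHk ?mulr0 // /= /bump /=; have := ltn_ord j; lia.
Qed.

Variable c : nat -> V.

Definition exponent n : {poly V} := \sum_(1 <= k < n.+1) (c k)%:P * 'X^k.

Definition exp_coef n : V :=
  \sum_(k < n.+1) (k`!%:R : F)^-1 *: (exponent n ^+ k)`_n.

Lemma coef_exponent n i :
  (exponent n)`_i = if (0 < i <= n)%N then c i else 0.
Proof.
rewrite coef_sum; under eq_bigr => k _ do rewrite coefCM coefXn mulr_natr mulrb.
rewrite -big_mkcond /=; under eq_bigl => k do rewrite eq_sym.
by rewrite big_nat1_eq ltnS.
Qed.

(** Neither truncation, of the exponent nor of the exponential series, affects the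
    coefficient of z^n, so that the same truncation may serve for all n <= N. *)
Lemma exp_coefE N M n : (n <= N)%N -> (n < M)%N ->
  exp_coef n = \sum_(k < M) (k`!%:R : F)^-1 *: (exponent N ^+ k)`_n.
Proof.
move=> nN nM; rewrite /exp_coef.
rewrite (big_ord_widen M (fun k => (k`!%:R)^-1 *: (exponent n ^+ k)`_n)) //.
rewrite big_mkcond; apply: eq_bigr => k _; case: ltnP => nk.
  congr (_ *: _); apply: (@coef_exp_eq _ _ n) => // i le_in.
  by rewrite !coef_exponent le_in (leq_trans le_in nN).
by rewrite coef_exp_eq0 ?scaler0 // coef_exponent.
Qed.

Lemma exp_coef0 : exp_coef 0 = 1.
Proof. by rewrite /exp_coef big_ord1 fact0 invr1 scale1r expr0 coef1. Qed.

(** The coefficient of z^n in z E'(z) = z g'(z) E(z), where E is the exponential of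
    g(z) = sum_k c_k z^k. *)
Lemma exp_coef_newton n : n%:R *: exp_coef n =
  \sum_(1 <= k < n.+1) k%:R *: (c k * exp_coef (n - k)).
Proof.
case: n => [|n]; first by rewrite scale0r big_geq.
rewrite big_add1 big_mkord /= [in LHS]/exp_coef scaler_sumr big_ord_recl.
rewrite expr0 coef1 /= !scaler0 add0r.
transitivity (\sum_(k < n.+1) (k`!%:R : F)^-1 *:
    \sum_(j < n.+1) (exponent n.+1)^`()`_j * (exponent n.+1 ^+ k)`_(n - j)).
  apply: eq_bigr => k _; rewrite (_ : bump 0 k = k.+1) // -coefM.
  have := coef_deriv (exponent n.+1 ^+ k.+1) n.
  rewrite deriv_exp /= coefMn => E.
  rewrite scalerA mulrC -scalerA scaler_nat -E factS natrM invfM -scaler_nat.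
  by rewrite scalerA mulrAC mulVf ?mul1r ?natrF_neq0.
under [LHS]eq_bigr => k _ do rewrite scaler_sumr.
rewrite exchange_big; apply: eq_bigr => j _ /=.
rewrite coef_deriv coef_exponent /= ltn_ord subSS.
rewrite (@exp_coefE n.+1 n.+1); last 2 first.
- by lia.
- by lia.
rewrite scaler_nat -mulrnAl mulr_sumr; apply: eq_bigr => k _.
by rewrite scalerAr.
Qed.
End Exponential.

(** * Shifting the power sums, and their adjoint derivations *)

Section HallLittlewood.
Variables (F : fieldType) (t : F) (V : comAlgType F).
Hypothesis natrF_neq0 : forall k, (0 < k)%N -> k%:R != 0 :> F.
Hypothesis tX_neq1 : forall k, (0 < k)%N -> 1 - t ^+ k != 0.

Variable p : nat -> V.
Hypothesis p_ind : forall P : V -> Prop,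
  P 1 -> (forall f h, P f -> P h -> P (f + h)) -> (forall c f, P f -> P (c *: f)) ->
  (forall k f, (0 < k)%N -> P f -> P (p k * f)) -> forall f, P f.

Variable subst : (nat -> {poly V}) -> {rmorphism V -> {poly V}}.
Hypothesis subst_p : forall g k, (0 < k)%N -> subst g (p k) = g k.
Hypothesis substZ : forall g c f, subst g (c *: f) = c%:A%:P * subst g f.

(** For [s = 1] this is the adjoint of multiplication by q_a, that is, the skewing
    by q_a; for [s = -1] it inverts that family of operators. *)
Definition skew (s : F) (a : nat) (f : V) : V :=
  (subst (fun i => (p i)%:P + s%:A *: 'X^i) f)`_a.

Fact skew_linear s a : linear (skew s a).
Proof.
by move=> c f h; rewrite /skew rmorphD /= substZ coefD coefCM mulr_algl.
Qed.
HB.instance Definition _ s a :=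
  GRing.isLinear.Build F V V *:%R (skew s a) (skew_linear s a).

Lemma skew1 s a : skew s a 1 = (a == 0%N)%:R.
Proof. by rewrite /skew rmorph1 coef1. Qed.

Lemma skewM s a f h :
  skew s a (f * h) = \sum_(i < a.+1) skew s i f * skew s (a - i) h.
Proof. by rewrite /skew rmorphM coefM. Qed.

Lemma skew_pM s a k f : (0 < k)%N ->
  skew s a (p k * f) =
  p k * skew s a f + (if (k <= a)%N then s *: skew s (a - k) f else 0).
Proof.
move=> k0; rewrite /skew rmorphM /= subst_p //= mulrDl coefD coefCM.
rewrite -scalerAl coefZ mulr_algl coefXnM ltnNge.
by case: leqP => _ /=; rewrite ?scaler0.
Qed.

Lemma skew_eq0 s f : exists N, forall a, (N <= a)%N -> skew s a f = 0.
Proof. by eexists => a; apply: nth_default. Qed.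

Lemma skew0 s f : skew s 0 f = f.
Proof.
elim/p_ind: f => [|f h IHf IHh|c f IHf|k f k0 IHf].
- by rewrite skew1.
- by rewrite linearD /= IHf IHh.
- by rewrite linearZ /= IHf.
by rewrite skew_pM // IHf leqNgt k0 addr0.
Qed.

Lemma skewC s s' a b f : skew s a (skew s' b f) = skew s' b (skew s a f).
Proof.
elim/p_ind: f a b => [|f h IHf IHh|c f IHf|k f k0 IHf] a b.
- by rewrite !skew1 !linearMn /= !skew1 -!mulrnA mulnC.
- by rewrite !linearD /= IHf IHh.
- by rewrite !linearZ /= IHf.
rewrite !skew_pM // !linearD /= !skew_pM // IHf -!addrA; congr (_ + _).
by rewrite addrC; congr (_ + _); case: ifP => _; rewrite ?linear0 ?linearZ //= IHf.
Qed.

(** <p_m, p_m> *)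
Definition pnorm (m : nat) : F := m%:R / (1 - t ^+ m).

(** The adjoint of multiplication by p_m, [pnorm m] times d/dp_m. Reading it off a
    ring homomorphism, as a coefficient of 'X, gives the Leibniz rule for free. *)
Definition padj (m : nat) (f : V) : V :=
  (subst (fun i => (p i)%:P + (if i == m then (pnorm m)%:A *: 'X else 0)) f)`_1.

Fact padj_linear m : linear (padj m).
Proof.
by move=> c f h; rewrite /padj rmorphD /= substZ coefD coefCM mulr_algl.
Qed.
HB.instance Definition _ m :=
  GRing.isLinear.Build F V V *:%R (padj m) (padj_linear m).

Lemma padjD m f h : padj m (f + h) = padj m f + padj m h.
Proof. exact: linearD. Qed.

Lemma padjZ m c f : padj m (c *: f) = c *: padj m f.
Proof. exact: linearZ. Qed.

Lemma padj1 m : padj m 1 = 0.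
Proof. by rewrite /padj rmorph1 coef1. Qed.

Lemma padjM m f h : padj m (f * h) = padj m f * h + f * padj m h.
Proof.
rewrite /padj; set g := (X in subst X).
have g0 x : (subst g x)`_0 = x.
  elim/p_ind: x => [|x y IHx IHy|c x IHx|k x k0 IHx].
  - by rewrite rmorph1 coef1.
  - by rewrite rmorphD /= coefD IHx IHy.
  - by rewrite substZ coefCM IHx mulr_algl.
  rewrite rmorphM /= coef0M IHx subst_p // coefD coefC /=.
  by case: eqP => _; rewrite ?coefZ ?coefX ?coef0 ?mulr0 addr0.
by rewrite rmorphM /= coefM big_ord_recl big_ord1 /= !g0 addrC.
Qed.

Lemma padj_p m k : (0 < k)%N ->
  padj m (p k) = (if k == m then pnorm m else 0)%:A.
Proof.
move=> k0; rewrite /padj subst_p // coefD coefC /= add0r.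
case: eqP => _; last by rewrite coef0 scale0r.
by rewrite coefZ coefX mulr1.
Qed.

Lemma padj_pM m k f : (0 < k)%N ->
  padj m (p k * f) = p k * padj m f + (if k == m then pnorm m *: f else 0).
Proof.
move=> k0; rewrite padjM padj_p // addrC mulr_algl.
by case: eqP; rewrite ?scale0r.
Qed.

Lemma padj_skewC m s a f : padj m (skew s a f) = skew s a (padj m f).
Proof.
elim/p_ind: f a => [|f h IHf IHh|c f IHf|k f k0 IHf] a.
- by rewrite padj1 skew1 linear0 -scaler_nat linearZ /= padj1 scaler0.
- by rewrite !linearD /= IHf IHh.
- by rewrite !linearZ /= IHf.
rewrite skew_pM // padj_pM // !linearD /= padj_pM // skew_pM // IHf.
rewrite -!addrA; congr (_ + _); rewrite addrC; congr (_ + _).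
  by case: ifP => _; rewrite ?linear0 ?linearZ /= ?IHf.
by case: ifP => _; rewrite ?linear0 ?linearZ.
Qed.

Lemma sum_truncate (G : nat -> V) a j :
  \sum_(1 <= k < a.+1) (if (j <= a - k)%N then G k else 0) =
  if (j <= a)%N then \sum_(1 <= k < (a - j).+1) G k else 0.
Proof.
case: leqP => [ja|aj]; last by rewrite big1 // => k _; rewrite ifF //; lia.
rewrite (big_cat_nat (n := (a - j).+1)) ?ltnS ?leq_subr //=.
rewrite [X in _ + X]big_nat_cond [X in _ + X]big1 ?addr0.
  by rewrite big_nat [RHS]big_nat; apply: eq_bigr => k hk; rewrite ifT //; lia.
by move=> k /andP[hk _]; rewrite ifF //; lia.
Qed.

Lemma scale_ifr (b : bool) c (f : V) :
  c *: (if b then f else 0) = if b then c *: f else 0.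
Proof. by case: b; rewrite ?scaler0. Qed.

Lemma mul_ifr (b : bool) (h f : V) :
  h * (if b then f else 0) = if b then h * f else 0.
Proof. by case: b; rewrite ?mulr0. Qed.

Lemma pnormE j (f : V) : (0 < j)%N -> (1 - t ^+ j) *: (pnorm j *: f) = j%:R *: f.
Proof. by move=> j0; rewrite scalerA /pnorm mulrC divfK // tX_neq1. Qed.

Lemma sum_pnorm (G : nat -> V) a j : (0 < j)%N ->
  \sum_(1 <= k < a.+1) (1 - t ^+ k) *: (if j == k then pnorm k *: G k else 0) =
  if (j <= a)%N then j%:R *: G j else 0.
Proof.
move=> j0; case: leqP => [ja|aj].
  rewrite (bigD1_seq j) ?iota_uniq ?mem_index_iota ?j0 //= eqxx big1 ?addr0.
    exact: pnormE.
  by move=> k; rewrite eq_sym => /negPf ->; rewrite scaler0.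
rewrite big_nat big1 // => k hk.
by rewrite ifF ?scaler0 //; apply/eqP; lia.
Qed.

(** Both sides are the coefficient of z^a in a derivation along the substitution
    p_k -> p_k + s z^k: the left one is z d/dz, and the right one the chain rule
    sum_k s k z^k d/dp_k. Hence it suffices to compare them on the p_k. *)
Lemma skew_newton s a f : a%:R *: skew s a f =
  s *: \sum_(1 <= k < a.+1) (1 - t ^+ k) *: skew s (a - k) (padj k f).
Proof.
elim/p_ind: f a => [|f h IHf IHh|c f IHf|j f j0 IHf] a.
- rewrite skew1 -scalerMnr big1 ?scaler0.
    by case: a => [|a]; rewrite ?mulr0n ?scale0r ?mul0rn.
  by move=> k _; rewrite padj1 linear0 scaler0.
- rewrite linearD /= scalerDr IHf IHh -scalerDr -big_split /=; congr (_ *: _).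
  by apply: eq_bigr => k _; rewrite !linearD.
- rewrite linearZ /= scalerA mulrC -scalerA IHf scalerA mulrC -scalerA.
  congr (_ *: _); rewrite scaler_sumr; apply: eq_bigr => k _.
  by rewrite !linearZ /= !scalerA mulrC.
rewrite skew_pM // scalerDr scalerAr IHf.
under [in RHS]eq_bigr => k _ do rewrite padj_pM // linearD /= skew_pM //.
under [in RHS]eq_bigr => k _ do rewrite 2!scalerDr scalerAr.
rewrite !big_split /= -mulr_sumr -addrA scalerDr scalerAr; congr (_ + _).
have -> : \sum_(1 <= k < a.+1) (1 - t ^+ k) *:
    (if (j <= a - k)%N then s *: skew s (a - k - j) (padj k f) else 0) =
    if (j <= a)%N then (a - j)%:R *: skew s (a - j) f else 0.
  under eq_bigr => k _ do rewrite scale_ifr.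
  rewrite sum_truncate; case: leqP => // _; rewrite IHf scaler_sumr.
  by apply: eq_bigr => k _; rewrite !scalerA mulrC subnAC.
have -> : \sum_(1 <= k < a.+1) (1 - t ^+ k) *:
    skew s (a - k) (if j == k then pnorm k *: f else 0) =
    if (j <= a)%N then j%:R *: skew s (a - j) f else 0.
  rewrite -(sum_pnorm (fun k => skew s (a - k) f)) //; apply: eq_bigr => k _.
  by case: eqP; rewrite ?linear0 ?linearZ.
case: leqP => [ja|_]; last by rewrite addr0 !scaler0.
by rewrite -scalerDl -natrD subnK // !scalerA mulrC.
Qed.

Variable q : nat -> V.
Hypothesis q0 : q 0 = 1.
Hypothesis q_newton : forall n,
  n%:R *: q n = \sum_(1 <= k < n.+1) (1 - t ^+ k) *: (p k * q (n - k)%N).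

Lemma padj_q m n : (0 < m)%N ->
  padj m (q n) = if (m <= n)%N then q (n - m) else 0.
Proof.
move=> m0; have [N] := ubnP n; elim: N n => // N IHN [|n] ltnN.
  by rewrite q0 padj1 leqNgt m0.
apply: (scalerI (natrF_neq0 (ltn0Sn n))); rewrite -linearZ q_newton linear_sum /=.
rewrite big_nat; under eq_bigr => k hk.
  rewrite linearZ /= padj_pM; last by lia.
  rewrite IHN; last by lia.
  rewrite scalerDr mul_ifr scale_ifr.
  over.
rewrite /= -big_nat big_split /= sum_truncate.
have -> : \sum_(1 <= k < n.+2)
    (1 - t ^+ k) *: (if k == m then pnorm m *: q (n.+1 - k) else 0) =
    if (m <= n.+1)%N then m%:R *: q (n.+1 - m) else 0.
  rewrite -(sum_pnorm (fun k => q (n.+1 - k))) //; apply: eq_bigr => k _.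
  by rewrite eq_sym; case: eqP => // ->.
case: leqP => [mn|_]; last by rewrite addr0 scaler0.
have -> : n.+1%:R = (n.+1 - m)%:R + m%:R :> F by rewrite -natrD subnK.
rewrite scalerDl q_newton; congr (_ + _).
by apply: eq_bigr => k _; rewrite subnAC.
Qed.

(** By [skew_newton] and [padj_q], the coefficients that relate [skew s a (q n)] to
    q_(n - a) satisfy a recursion in which n does not occur. *)
Lemma skew_q s (e : nat -> F) :
    e 0%N = 1 ->
    (forall n, n%:R * e n = s * \sum_(1 <= k < n.+1) (1 - t ^+ k) * e (n - k)%N) ->
  forall a n, skew s a (q n) = if (a <= n)%N then e a *: q (n - a) else 0.
Proof.
move=> e0 eN a; have [N] := ubnP a; elim: N a => // N IHN [|a] ltaN n.
  by rewrite skew0 e0 scale1r subn0.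
apply: (scalerI (natrF_neq0 (ltn0Sn a))); rewrite skew_newton big_nat.
under eq_bigr => k hk.
  rewrite padj_q; last by lia.
  have -> : skew s (a.+1 - k) (if (k <= n)%N then q (n - k) else 0) =
      if (a < n)%N then e (a.+1 - k)%N *: q (n - a.+1) else 0.
    case: (leqP k n) => kn; last by rewrite linear0 ifF //; lia.
    rewrite IHN; last by lia.
    rewrite (_ : (a.+1 - k <= n - k)%N = (a < n)%N); last by lia.
    case: ltnP => // an; congr (_ *: _).
    by have -> : (n - k - (a.+1 - k) = n - a.+1)%N by lia.
  rewrite scale_ifr scalerA.
  over.
rewrite /= -big_nat; case: leqP => _; first by rewrite big1 ?scaler0.
by rewrite -scaler_suml scalerA -eN scalerA.
Qed.

Definition qi (m : int) : V := if m is Posz n then q n else 0.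

Lemma qi_neg m : m < 0 -> qi m = 0.
Proof. by case: m. Qed.

Lemma qiB (a n : nat) : qi (n%:Z - a%:Z) = if (a <= n)%N then q (n - a) else 0.
Proof.
case: leqP => an; first by rewrite subzn.
by rewrite qi_neg // subr_lt0.
Qed.

Lemma padj_qi m x : (0 < m)%N -> padj m (qi x) = qi (x - m%:Z).
Proof.
move=> m0; case: x => n; last by rewrite linear0 qi_neg //; lia.
by rewrite qiB -padj_q.
Qed.

(** The coefficients of (1 - t u) / (1 - u). *)
Definition expand_coef (n : nat) : F := if n is 0 then 1 else 1 - t.
(** The coefficients of (1 - R) / (1 - t R), inverse to the preceding series. *)
Definition raise_coef (n : nat) : F :=
  t ^+ n - (if n is n'.+1 then t ^+ n' else 0).

Lemma expand_coef_newton n : n%:R * expand_coef n =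
  1 * \sum_(1 <= k < n.+1) (1 - t ^+ k) * expand_coef (n - k)%N.
Proof.
case: n => [|n]; first by rewrite big_geq // mulr0 mul0r.
rewrite big_nat_recr //= subnn mul1r mulr1.
transitivity (\sum_(1 <= k < n.+1) (1 - t ^+ k) * (1 - t) + (1 - t ^+ n.+1)).
  elim: n => [|n IHn]; first by rewrite big_geq // add0r mul1r expr1.
  by rewrite -natr1 mulrDl IHn [in RHS]big_nat_recr //= !exprS; ring.
congr (_ + _); apply: eq_big_nat => k hk.
by rewrite subSn //; lia.
Qed.

Lemma raise_coef_newton n : n%:R * raise_coef n =
  -1 * \sum_(1 <= k < n.+1) (1 - t ^+ k) * raise_coef (n - k)%N.
Proof.
case: n => [|n]; first by rewrite big_geq // mulr0 mul0r.
rewrite big_nat_recr //= subnn /raise_coef subr0 mulr1.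
transitivity (-1 * (\sum_(1 <= k < n.+1)
    (1 - t ^+ k) * (t ^+ (n - k).+1 - t ^+ (n - k)) + (1 - t ^+ n.+1))).
  elim: n => [|n IHn]; first by rewrite big_geq // add0r mul1r expr1 expr0; ring.
  rewrite [in RHS]big_nat_recr //= subnn.
  have -> : \sum_(1 <= k < n.+1)
      (1 - t ^+ k) * (t ^+ (n.+1 - k).+1 - t ^+ (n.+1 - k)) =
      t * \sum_(1 <= k < n.+1) (1 - t ^+ k) * (t ^+ (n - k).+1 - t ^+ (n - k)).
    rewrite mulr_sumr big_nat [RHS]big_nat; apply: eq_bigr => k hk.
    by rewrite subSn; [rewrite !exprS; ring | lia].
  have -> : n.+2%:R * (t ^+ n.+2 - t ^+ n.+1) =
      t * (n.+1%:R * (t ^+ n.+1 - t ^+ n)) + (t ^+ n.+2 - t ^+ n.+1).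
    by rewrite -natr1 !exprS; ring.
  by rewrite IHn !exprS; ring.
congr (_ * (_ + _)); apply: eq_big_nat => k hk.
by rewrite subSn //; lia.
Qed.

Lemma skew_qi s e : e 0%N = 1 ->
    (forall n, n%:R * e n = s * \sum_(1 <= k < n.+1) (1 - t ^+ k) * e (n - k)%N) ->
  forall a x, skew s a (qi x) = e a *: qi (x - a%:Z).
Proof.
move=> e0 eN a [n|n]; last by rewrite linear0 qi_neg ?scaler0 //; lia.
by rewrite qiB /= (skew_q e0 eN) scale_ifr.
Qed.

Lemma add_skew_qi a x : skew 1 a (qi x) = expand_coef a *: qi (x - a%:Z).
Proof. exact: (skew_qi (erefl : expand_coef 0 = 1) expand_coef_newton). Qed.

Lemma sub_skew_qi a x : skew (-1) a (qi x) = raise_coef a *: qi (x - a%:Z).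
Proof. by apply: (skew_qi _ raise_coef_newton); rewrite /raise_coef subr0. Qed.


Lemma sum_widen (G : nat -> V) N M : (forall b, (N <= b)%N -> G b = 0) ->
  (N <= M)%N -> \sum_(b < M) G b = \sum_(b < N) G b.
Proof.
move=> G0 NM; rewrite -!(big_mkord xpredT) (big_cat_nat (n := N)) //=.
by rewrite [X in _ + X]big_nat [X in _ + X]big1 ?addr0 // => b /andP[/G0].
Qed.

(** Summation along the diagonals b + c = s, for a function supported in the box. *)
Lemma sum_box (K : nat -> nat -> V) N M :
    (forall b c, (N <= b)%N -> K b c = 0) ->
    (forall b c, (M <= c)%N -> K b c = 0) ->
  \sum_(b < N) \sum_(c < M) K b c =
  \sum_(s < N + M) \sum_(b < s.+1) K b (s - b)%N.
Proof.
move=> K0l K0r.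
transitivity (\sum_(b < N + M) \sum_(c < N + M) K b c).
  rewrite [RHS](@sum_widen (fun b => \sum_(c < N + M) K b c) N) ?leq_addr //.
    by apply: eq_bigr => b _; rewrite (@sum_widen (K b) M) ?leq_addl //; apply: K0r.
  by move=> b Nb; apply: big1 => c _; apply: K0l.
have E s : (s < N + M)%N ->
    \sum_(b < s.+1) K b (s - b)%N = \sum_(b < N + M | (b <= s)%N) K b (s - b)%N.
  move=> lts; rewrite (big_ord_widen (N + M) (fun b => K b (s - b)%N)) //.
under [RHS]eq_bigr => s _ do rewrite E ?ltn_ord //.
rewrite [RHS](exchange_big_dep xpredT) //=; apply: eq_bigr => b _.
rewrite -(big_mkord (fun s => (b <= s)%N) (fun s => K b (s - b)%N)).
rewrite (big_cat_nat (n := b)) ?(ltnW (ltn_ord b)) //=.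
rewrite [X in X + _]big_nat_cond [X in X + _]big1 ?add0r; last first.
  by move=> s; case: leqP => //; case: ltnP => //; rewrite ?andbF.
rewrite [RHS](big_addn 0 _ b).
rewrite -(big_mkord xpredT) (big_cat_nat (n := (N + M - b)%N)) ?leq_subr //=.
rewrite [X in _ + X]big_nat_cond [X in _ + X]big1 ?addr0.
  by apply: eq_big => [c|c _]; rewrite ?leq_addl ?addnK.
move=> c /andP[/andP[hc _] _].
case: (leqP N b) => Nb; first exact: K0l.
by apply: K0r; lia.
Qed.

(** * Vertex operators *)

(** The sum runs over all b for which the coefficient of z^b can be nonzero. *)
Definition vertex (m : int) (f : V) : V :=
  \sum_(b < size (subst (fun i => (p i)%:P + (-1)%:A *: 'X^i) f))
    qi (m + b%:Z) * skew (-1) b f.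

Lemma vertexE N m f : (forall a, (N <= a)%N -> skew (-1) a f = 0) ->
  vertex m f = \sum_(b < N) qi (m + b%:Z) * skew (-1) b f.
Proof.
move=> f0; rewrite /vertex; set S := size _.
have S0 b : (S <= b)%N -> skew (-1) b f = 0 by apply: nth_default.
pose G (b : nat) := qi (m + b%:Z) * skew (-1) b f.
rewrite -(@sum_widen G S (maxn S N)) ?leq_maxl //.
  rewrite -(@sum_widen G N (maxn S N)) ?leq_maxr // => b /f0.
  by rewrite /G => ->; rewrite mulr0.
by move=> b /S0; rewrite /G => ->; rewrite mulr0.
Qed.

Lemma skew_bound s f g :
  exists N, forall a, (N <= a)%N -> skew s a f = 0 /\ skew s a g = 0.
Proof.
have [[N fN] [M gM]] := (skew_eq0 s f, skew_eq0 s g).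
by exists (maxn N M) => a; rewrite geq_max => /andP[/fN ? /gM].
Qed.

Fact vertex_linear m : linear (vertex m).
Proof.
move=> c f h; have [N fhN] := skew_bound (-1) f h.
rewrite !(@vertexE N) => [|a /fhN[]//|a /fhN[]//|a /fhN[f0 h0]]; last first.
  by rewrite linearP /= f0 h0 scaler0 addr0.
rewrite scaler_sumr -big_split; apply: eq_bigr => b _ /=.
by rewrite linearP /= mulrDr scalerAr.
Qed.
HB.instance Definition _ m :=
  GRing.isLinear.Build F V V *:%R (vertex m) (vertex_linear m).

Lemma vertex1 m : vertex m 1 = qi m.
Proof.
rewrite (@vertexE 1) => [|[]// a _]; last by rewrite skew1.
by rewrite big_ord1 skew1 addr0 mulr1.
Qed.

Lemma padj_vertex m n f : (0 < m)%N ->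
  padj m (vertex n f) = vertex (n - m%:Z) f + vertex n (padj m f).
Proof.
move=> m0; have [N fN] := skew_eq0 (-1) f.
rewrite !(@vertexE N) => [|a /fN f0|//|//]; last by rewrite -padj_skewC f0 linear0.
rewrite linear_sum -big_split; apply: eq_bigr => b _ /=.
by rewrite padjM padj_qi // padj_skewC addrAC.
Qed.

Lemma add_skew_vertex a m f : skew 1 a (vertex m f) =
  \sum_(c < a.+1) expand_coef c *: vertex (m - c%:Z) (skew 1 (a - c) f).
Proof.
have [N fN] := skew_eq0 (-1) f.
under eq_bigr => c _.
  rewrite (@vertexE N); last by move=> b /fN f0; rewrite skewC f0 linear0.
  rewrite scaler_sumr.
  over.
rewrite (vertexE _ fN) linear_sum exchange_big; apply: eq_bigr => b _ /=.
rewrite skewM; apply: eq_bigr => c _.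
by rewrite add_skew_qi skewC -scalerAl addrAC.
Qed.

(** The substitutions p_k -> p_k + z^k and p_k -> p_k - z^k are mutually inverse. *)
Lemma sub_skewK s f :
  \sum_(b < s.+1) skew (-1) (s - b) (skew 1 b f) = if s == 0%N then f else 0.
Proof.
elim/p_ind: f s => [|f h IHf IHh|c f IHf|k f k0 IHf] s.
- rewrite (bigD1 ord0) //= subn0 !skew1 big1 => [|i]; last first.
    by rewrite skew1 -val_eqE /= => /negPf->; rewrite linear0.
  by rewrite addr0; case: eqP.
- under eq_bigr => b _ do rewrite !linearD.
  by rewrite big_split /= IHf IHh; case: eqP; rewrite ?addr0.
- under eq_bigr => b _ do rewrite !linearZ.
  by rewrite -scaler_sumr IHf scale_ifr.
under eq_bigr => b _ do rewrite skew_pM // linearD /= skew_pM // scale1r.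
rewrite !big_split /= -mulr_sumr IHf mul_ifr -addrA.
rewrite [X in _ + X](_ : _ = 0) ?addr0 //.
pose G (b : nat) := skew (-1) (s - k - b) (skew 1 b f).
case: (leqP k s) => ks; last first.
  rewrite !big1 ?addr0 // => b _; last by rewrite ifF //; lia.
  by rewrite ifF ?linear0 //; have := ltn_ord b; lia.
transitivity (- \sum_(b < (s - k).+1) G b + \sum_(b < (s - k).+1) G b); last first.
  by rewrite addNr.
congr (_ + _).
  rewrite -sumrN [RHS](@big_ord_widen _ _ _ _ s.+1 (fun b => - G b)); last first.
    by rewrite ltnS leq_subr.
  rewrite [RHS]big_mkcond; apply: eq_bigr => b _ /=; rewrite scaleN1r /G.
  have := ltn_ord b => hb.
  rewrite (_ : (k <= s - b)%N = (b < (s - k).+1)%N); last by lia.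
  by rewrite subnAC.
rewrite -(big_mkord xpredT G) -(big_mkord xpredT
  (fun i => skew (-1) (s - i) (if (k <= i)%N then skew 1 (i - k) f else 0))).
rewrite (big_cat_nat (n := k)) //=; last exact: leq_trans ks _.
rewrite big_nat big1 ?add0r => [|i hi]; last by rewrite ifF ?linear0 //; lia.
rewrite (big_addn 0 _ k) subSn //; apply: eq_bigr => i _.
by rewrite leq_addl addnK /G subnDA subnAC.
Qed.

(** The double sum over b and c, arranged by s = b + c, has the inner sums of
    [sub_skewK], which vanish unless s = 0. *)
Lemma vertex_add_skew N m f : (forall b, (N <= b)%N -> skew 1 b f = 0) ->
  \sum_(b < N) vertex (m + b%:Z) (skew 1 b f) = qi m * f.
Proof.
move=> fN; have [M fM] := skew_eq0 (-1) f.
pose K b c := qi (m + (b + c)%N%:Z) * skew (-1) c (skew 1 b f).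
transitivity (\sum_(b < N) \sum_(c < M) K b c).
  apply: eq_bigr => b _; rewrite (@vertexE M) => [|a /fM f0]; last first.
    by rewrite skewC f0 linear0.
  by apply: eq_bigr => c _; rewrite /K PoszD addrA.
rewrite sum_box => [|b c /fN f0|b c /fM f0]; last 2 first.
- by rewrite /K f0 linear0 mulr0.
- by rewrite /K skewC f0 linear0 mulr0.
have E s : \sum_(b < s.+1) K b (s - b)%N = if s == 0%N then qi m * f else 0.
  transitivity (qi (m + s%:Z) * \sum_(b < s.+1) skew (-1) (s - b) (skew 1 b f)).
    rewrite mulr_sumr; apply: eq_bigr => b _; rewrite /K subnKC //.
    by rewrite -ltnS.
  by rewrite sub_skewK mul_ifr; case: eqP => // ->; rewrite addr0.
under eq_bigr => s _ do rewrite E.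
case: (N + M)%N (leq_addr M N) => [|n _]; last first.
  by rewrite big_ord_recl /= big1 ?addr0.
rewrite leqn0 => /eqP N0; rewrite big_ord0 -(skew0 1 f) fN ?N0 ?mulr0 //.
Qed.

(** G(x, y) is the sum over b and c of q_(x + b) q_(y + c) f_(b, c), where f_(b, c)
    is symmetric in b and c because the substitutions commute. Moving the
    substitution of the outer operator past the inner q_(r + c) produces the
    coefficients [raise_coef]. *)
Lemma vertex2E f : exists2 G : int -> int -> V,
  (forall x y, G x y = G y x) &
  forall s r, exists D0, forall D, (D0 <= D)%N ->
    vertex s (vertex r f) = \sum_(d < D) raise_coef d *: G (s + d%:Z) (r - d%:Z).
Proof.
have [N fN] := skew_eq0 (-1) f.
pose G (x y : int) := \sum_(b < N) \sum_(c < N)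
  qi (x + b%:Z) * qi (y + c%:Z) * skew (-1) b (skew (-1) c f).
exists G => [x y|s r].
  rewrite /G exchange_big; apply: eq_bigr => c _; apply: eq_bigr => b _ /=.
  by rewrite skewC [qi _ * qi _]mulrC.
exists (`|r| + N)%N => D leD.
(* For d >= D every index r + c - d with c < N is negative. *)
have rD d c : (D <= d)%N -> (c < N)%N -> qi (r + c%:Z - d%:Z) = 0.
  by move=> *; apply: qi_neg; lia.
pose K d b := \sum_(c < N) raise_coef d *:
  (qi (s + d%:Z + b%:Z) * qi (r - d%:Z + c%:Z) * skew (-1) b (skew (-1) c f)).
have -> : \sum_(d < D) raise_coef d *: G (s + d%:Z) (r - d%:Z) =
    \sum_(d < D) \sum_(b < N) K d b.
  apply: eq_bigr => d _; rewrite scaler_sumr; apply: eq_bigr => b _.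
  by rewrite scaler_sumr.
have skew_vertex b : skew (-1) b (vertex r f) = \sum_(d < b.+1) \sum_(c < N)
    raise_coef d *: (qi (r - d%:Z + c%:Z) * skew (-1) (b - d) (skew (-1) c f)).
  rewrite (vertexE _ fN) linear_sum exchange_big; apply: eq_bigr => c _ /=.
  rewrite skewM; apply: eq_bigr => d _.
  by rewrite sub_skew_qi -scalerAl addrAC.
rewrite sum_box => [|d b Dd|d b /fN f0]; last 2 first.
- apply: big1 => c _; rewrite [r - _ + _]addrAC rD // mulr0 mul0r scaler0 //.
- by apply: big1 => c _; rewrite skewC f0 linear0 mulr0 scaler0.
rewrite (@vertexE (D + N)) => [|b leb]; last first.
  rewrite skew_vertex big1 // => d _; apply: big1 => c _.
  have [Dd|dD] := leqP D d; first by rewrite addrAC rD // mul0r scaler0.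
  by rewrite skewC fN ?linear0 ?mulr0 ?scaler0 //; lia.
apply: eq_bigr => b _; rewrite skew_vertex mulr_sumr; apply: eq_bigr => d _.
rewrite mulr_sumr; apply: eq_bigr => c _.
rewrite -scalerAr mulrA; congr (_ *: (qi _ * _ * _)).
by rewrite -addrA -PoszD subnKC // -ltnS.
Qed.

(** The identity (1 - t u) * (1 - u) / (1 - t u) = 1 - u, for truncated sums. *)
Lemma raise_coef_telescope (H : nat -> V) n :
  \sum_(d < n.+2) raise_coef d *: H d -
    t *: (\sum_(d < n.+1) raise_coef d *: H d.+1) = H 0%N - H 1%N.
Proof.
elim: n => [|n IHn].
  rewrite !big_ord_recr !big_ord0 /= /raise_coef !add0r subr0 !scale1r expr1.
  by rewrite scalerBl scale1r -addrA addrAC subrr add0r.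
rewrite big_ord_recr [in X in _ - X]big_ord_recr /= scalerDr opprD addrACA IHn.
by rewrite scalerA -scalerBl /raise_coef mulrBr -!exprS subrr scale0r addr0.
Qed.

(** With x = s, y = r and with x = r - 1, y = s + 1, the differences below are
    opposite to each other, because G is symmetric. *)
Lemma vertex_exchange s r f :
  vertex s (vertex r f) + vertex (r - 1) (vertex (s + 1) f) =
  t *: (vertex (s + 1) (vertex (r - 1) f) + vertex r (vertex s f)).
Proof.
have [G Gsym GE] := vertex2E f.
have A x y : vertex x (vertex y f) - t *: vertex (x + 1) (vertex (y - 1) f) =
    G x y - G (x + 1) (y - 1).
  have [[D1 E1] [D2 E2]] := (GE x y, GE (x + 1) (y - 1)).
  rewrite (E1 (maxn D1 D2).+2) ?(E2 (maxn D1 D2).+1); last 2 first.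
  - by lia.
  - by lia.
  under [in X in _ - X]eq_bigr => d _.
    rewrite (_ : x + 1 + d%:Z = x + d.+1%:Z); last by lia.
    rewrite (_ : y - 1 - d%:Z = y - d.+1%:Z); last by lia.
    over.
  rewrite (raise_coef_telescope (fun d => G (x + d%:Z) (y - d%:Z))) /=.
  by rewrite addr0 subr0.
have := A s r; have := A (r - 1) (s + 1).
rewrite subrK addrK (Gsym (r - 1)) (Gsym r) => A1 A2.
apply/eqP; rewrite -subr_eq0 scalerDr opprD addrACA A2.
by rewrite A1 addrA subrK subrr.
Qed.
(** * Straightening *)

(** [d] is the size of the ascent. *)
Definition straight_coef (d a : nat) : F :=
  if a == 0%N then t
  else if (a < d./2)%N then t ^+ a.+1 - t ^+ a.-1
  else t ^+ (a + odd d) - t ^+ a.-1.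

(** The relation at (s, r) expresses c(s, r) by c(r, s), c(r - 1, s + 1) and
    c(s + 1, r - 1), and in the last of them the ascent has decreased by two. At
    ascent 1 the terms c(s, r) and c(r - 1, s + 1) coincide, and one divides by 2. *)
Lemma straighten_pair (c : int -> int -> V) :
    (forall s r, c s r + c (r - 1) (s + 1) = t *: (c (s + 1) (r - 1) + c r s)) ->
  forall d s, c s (s + d.+1%:Z) = \sum_(a < (d.+1)./2.+1)
    straight_coef d.+1 a *: c (s + d.+1%:Z - a%:Z) (s + a%:Z).
Proof.
move=> cE d; have [N] := ubnP d; elim: N d => // N IHN [|[|d]] ltdN s.
- rewrite big_ord1 /straight_coef /= addr0 subr0.
  apply: (scalerI (natrF_neq0 (isT : (0 < 2)%N))).
  by have := cE s (s + 1); rewrite addrK -!mulr2n -!scaler_nat scalerA mulrC -scalerA.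
- rewrite !big_ord_recr big_ord0 /= /straight_coef /= add0r addr0 subr0.
  have := cE s (s + 2); rewrite (_ : s + 2 - 1 = s + 1); last by lia.
  rewrite (_ : s + (1 + 1)%N = s + 2) // => /(canRL (addrK _)) ->.
  by rewrite scalerDr scalerBl scale1r addrAC addrC addrA.
have := cE s (s + d.+3%:Z) => /(canRL (addrK _)) ->.
rewrite (_ : s + d.+3%:Z - 1 = s + 1 + d.+1%:Z); last by lia.
rewrite IHN; last by lia.
rewrite scalerDr [t *: _ + _]addrC -addrA [RHS]big_ord_recl; congr (_ + _).
  by rewrite subr0 addr0.
rewrite /= scaler_sumr [RHS]big_ord_recl [in LHS]big_ord_recl /=.
rewrite addrAC; congr (_ + _).
  rewrite scalerA /bump /= addn0 (_ : s + d.+3%:Z - _ = s + 1 + d.+1%:Z); last by lia.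
  rewrite (_ : s + 1 + d.+1%:Z - 0 = s + 1 + d.+1%:Z); last by lia.
  rewrite (_ : s + 1 + 0 = s + 1); last by lia.
  rewrite -[X in _ - X]scale1r -scalerBl; congr (_ *: _).
  rewrite /straight_coef /= negbK.
  by case: d {ltdN} => [|[|d]] //=.
apply: eq_bigr => a _; rewrite scalerA /bump /= !add1n.
congr (_ *: c _ _); [|lia|lia].
rewrite /straight_coef /= negbK ltnS; case: ifP => _.
  by rewrite mulrBr -!exprS.
by rewrite mulrBr -!exprS.
Qed.

(** * Hall-Littlewood functions of integer tuples *)
Definition HLtuple (al : seq int) : V := foldr vertex 1 al.

Lemma foldr_vertex_sum n (k : nat -> F) (G : nat -> V) al :
  foldr vertex (\sum_(i < n) k i *: G i) al = \sum_(i < n) k i *: foldr vertex (G i) al.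
Proof.
elim: al => //= x al ->; rewrite linear_sum; apply: eq_bigr => i _.
by rewrite linearZ.
Qed.

Lemma HLtuple_straighten u x y v : x < y ->
  HLtuple (u ++ [:: x, y & v]) = \sum_(a < (absz (y - x))./2.+1)
    straight_coef (absz (y - x)) a *: HLtuple (u ++ [:: y - a%:Z, x + a%:Z & v]).
Proof.
move=> ltxy; have [d Ed] : exists d, absz (y - x) = d.+1.
  by exists (absz (y - x)).-1; lia.
rewrite Ed (_ : y = x + d.+1%:Z); last by lia.
rewrite {1}/HLtuple foldr_cat /=.
rewrite (@straighten_pair (fun s r => vertex s (vertex r (HLtuple v)))); last first.
  by move=> s r; rewrite vertex_exchange.
rewrite (foldr_vertex_sum _ (straight_coef d.+1)
  (fun a => vertex (x + d.+1%:Z - a%:Z) (vertex (x + a%:Z) (HLtuple v)))).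
apply: eq_bigr => a _; rewrite /HLtuple foldr_cat /=; congr (_ *: foldr _ _ _).
Qed.

Lemma HLtuple_rcons_neg al x : x < 0 -> HLtuple (rcons al x) = 0.
Proof.
move=> x0; rewrite /HLtuple foldr_rcons vertex1 qi_neg //.
by elim: al => //= y al ->; rewrite linear0.
Qed.

Lemma HLtuple_nseq0 n : HLtuple (nseq n 0) = 1.
Proof. by elim: n => //= n IHn; rewrite IHn vertex1 /= q0. Qed.

Definition sub_at (m : int) (j : nat) (al : seq int) : seq int :=
  mkseq (fun i => al`_i - (if i == j then m else 0)) (size al).

Lemma sub_at0 m x al : sub_at m 0 (x :: al) = x - m :: al.
Proof.
rewrite /sub_at /mkseq /= (iotaDl 1) -map_comp; congr (_ :: _).
apply: (@eq_from_nth _ 0) => [|i]; rewrite size_map size_iota // => hi.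
by rewrite (nth_map 0%N) ?size_iota // nth_iota //= subr0.
Qed.

Lemma sub_atS m j x al : sub_at m j.+1 (x :: al) = x :: sub_at m j al.
Proof.
rewrite /sub_at /mkseq /= subr0 (iotaDl 1) -map_comp; congr (_ :: _).
Qed.

Lemma sum_sub_at m j al : (j < size al)%N ->
  \sum_(x <- sub_at m j al) x = \sum_(x <- al) x - m.
Proof.
elim: al j => // x al IHal [|j] ltj; first by rewrite sub_at0 !big_cons addrAC.
by rewrite sub_atS !big_cons IHal // addrA.
Qed.

Lemma padj_HLtuple m al : (0 < m)%N ->
  padj m (HLtuple al) = \sum_(j < size al) HLtuple (sub_at m%:Z j al).
Proof.
move=> m0; elim: al => [|x al IHal]; first by rewrite big_ord0 padj1.
rewrite [HLtuple (x :: al)]/(vertex x (HLtuple al)) padj_vertex // IHal linear_sum.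
rewrite big_ord_recl (sub_at0 m%:Z x al); congr (_ + _).
by apply: eq_bigr => j _; rewrite (sub_atS m%:Z j x al).
Qed.

(** * Orthogonality *)
Definition HLpart (la : seq nat) : V := HLtuple (map Posz la).

(** H_0 1 = q_0 = 1, so that trailing zeros may be dropped. *)
Lemma HLtuple_parts al : sorted (fun x y => y <= x) al ->
  all (fun x => 0 <= x) al ->
  HLtuple al = HLpart [seq absz x | x <- al & x != 0].
Proof.
elim: al => //= x al IHal xal /andP[x0 al0].
have [x_eq0|x_neq0] := eqVneq x 0 => /=; last first.
  by rewrite /HLpart /= -/(HLtuple _) IHal ?(path_sorted xal) // gez0_abs.
have al_eq0 : all (pred1 0) al.
  have := order_path_min (fun y x z xy yz => le_trans yz xy) xal.
  move=> /allP alx; apply/allP => y yal /=; rewrite eq_le.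
  by rewrite (allP al0) // andbT -x_eq0 alx.
have /all_pred1P E := al_eq0; rewrite E x_eq0.
have := HLtuple_nseq0 (size al).+1 => /= ->.
by have -> : [seq x <- nseq (size al) 0 | x != 0] = [::] :> seq int by elim: (size al).
Qed.

(** In [add_skew_vertex] the terms with c > 0 have the coefficient 1 - t, and the
    term with c = 0 has the coefficient 1 = (1 - t) + t. The part with 1 - t adds up
    by [vertex_add_skew], as [skew 1 b f] vanishes for b > a. *)
Lemma skew_vertex_top a m f : (forall b, (a < b)%N -> skew 1 b f = 0) ->
  skew 1 a (vertex m f) =
  (1 - t) *: (qi (m - a%:Z) * f) + t *: vertex m (skew 1 a f).
Proof.
move=> f0; rewrite add_skew_vertex -(@vertex_add_skew a.+1) //.
have -> : \sum_(b < a.+1) vertex (m - a%:Z + b%:Z) (skew 1 b f) =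
    \sum_(c < a.+1) vertex (m - c%:Z) (skew 1 (a - c) f).
  rewrite (reindex_inj rev_ord_inj); apply: eq_bigr => c _ /=.
  rewrite subSS (_ : m - a%:Z + (a - c)%N%:Z = m - c%:Z) //.
  by have := ltn_ord c; lia.
rewrite !big_ord_recl /= scale1r subr0 subn0 scalerDr addrAC -scalerDl subrK.
by rewrite scale1r scaler_sumr.
Qed.

(** By induction [skew_vertex_top] applies with f = Q_(mu_2, mu_3, ...). If a > mu_1,
    the factor q_(mu_1 - a) is 0. If a = mu_1, this factor is 1, and the second
    term contributes exactly when mu_2 = mu_1: then 1 - t + t (1 - t^k) =
    1 - t^(k + 1). *)
Lemma skew_HLpart mu : sorted geq mu -> 0%N \notin mu ->
  (forall a, (head 0 mu < a)%N -> skew 1 a (HLpart mu) = 0) /\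
  (forall m mu', mu = m :: mu' ->
     skew 1 m (HLpart mu) = (1 - t ^+ count_mem m mu) *: HLpart mu').
Proof.
elim: mu => [|m mu IHmu] /= smu mu0.
  by split=> // -[|a] // _; rewrite skew1.
move: mu0; rewrite inE negb_or => /andP[m0 mu0].
have [IH1 IH2] := IHmu (path_sorted smu) mu0.
have head_le : (head 0 mu <= m)%N by case: mu smu {IHmu IH1 IH2 mu0} => //= ? ? /andP[].
have top a : (m <= a)%N -> skew 1 a (HLpart (m :: mu)) =
    (1 - t) *: (qi (m%:Z - a%:Z) * HLpart mu) + t *: vertex m (skew 1 a (HLpart mu)).
  move=> ma; apply: skew_vertex_top => b ab; apply: IH1.
  exact: leq_ltn_trans head_le (leq_ltn_trans ma ab).
split=> [a ma|m1 mu1 [<- <-] {m1 mu1}].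
  rewrite top ?(ltnW ma) // IH1 ?(leq_ltn_trans head_le) // linear0 scaler0 addr0.
  by rewrite qi_neg ?mul0r ?scaler0 // subr_lt0.
rewrite top // subrr /= q0 mul1r eqxx.
have [mmu|m_mu] := boolP (head 0 mu == m); last first.
  rewrite IH1 ?ltn_neqAle ?m_mu // linear0 scaler0 addr0.
  rewrite (count_memPn _) ?addn0 ?expr1 //.
  case: mu smu m_mu head_le {IHmu IH1 IH2 mu0 top} => //= k mu /andP[km smu] neq _.
  rewrite inE negb_or eq_sym neq; apply/negP => mmu.
  have := order_path_min (fun x y z xy yz => leq_trans yz xy) smu.
  by move=> /allP/(_ _ mmu) mk; case/eqP: neq; apply/eqP; rewrite eqn_leq km.
case: mu mmu smu m0 IH2 {mu0 IHmu IH1 head_le top} => [/eqP<- //|k mu /= /eqP-> _ _].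
move=> /(_ _ _ erefl) ->; rewrite eqxx linearZ scalerA -scalerDl.
by congr (_ *: _); rewrite [in RHS]exprD expr1 mulrBr mulr1 addrA subrK.
Qed.

(* The scalar product, for which the p_lambda are orthogonal: with the symmetry
   and [hall_p], it is determined by its value at (1, 1). *)
Variable hall : V -> V -> F.
Hypothesis hallD : forall f g h, hall (f + g) h = hall f h + hall g h.
Hypothesis hallZ : forall c f h, hall (c *: f) h = c * hall f h.
Hypothesis hallC : forall f h, hall f h = hall h f.
Hypothesis hall11 : hall 1 1 = 1.
Hypothesis hall_p : forall k f h, (0 < k)%N -> hall (p k * f) h = hall f (padj k h).

Lemma hall0 h : hall 0 h = 0.
Proof. by rewrite -(scale0r 0) hallZ mul0r. Qed.

Lemma hall_sum (I : Type) (r : seq I) (G : I -> V) h :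
  hall (\sum_(i <- r) G i) h = \sum_(i <- r) hall (G i) h.
Proof. exact: (big_morph (hall^~ h) (fun f g => hallD f g h) (hall0 h)). Qed.

Lemma hallZr c f h : hall f (c *: h) = c * hall f h.
Proof. by rewrite hallC hallZ hallC. Qed.

(** The recursions for q_n and for [skew 1 n] are adjoint to each other, term by
    term. *)
Lemma hall_q n f h : hall (q n * f) h = hall f (skew 1 n h).
Proof.
have [N] := ubnP n; elim: N n f h => // N IHN [|n] f h ltnN.
  by rewrite q0 mul1r skew0.
apply: (mulfI (natrF_neq0 (ltn0Sn n))); rewrite -hallZ -hallZr skew_newton scale1r.
rewrite scalerAl q_newton mulr_suml.
pose G k : V := (1 - t ^+ k.+1) *: (p k.+1 * q (n - k) * f).
pose H k : V := (1 - t ^+ k.+1) *: skew 1 (n - k) (padj k.+1 h).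
rewrite !big_add1 !big_mkord.
transitivity (hall (\sum_(k < n.+1) G k) h).
  by congr hall; apply: eq_bigr => k _; rewrite -scalerAl subSS.
transitivity (hall f (\sum_(k < n.+1) H k)); last first.
  by congr hall; apply: eq_bigr => k _; rewrite subSS.
rewrite [RHS]hallC !hall_sum; apply: eq_bigr => k _; rewrite !hallZ -mulrA.
by rewrite hall_p // IHN 1?hallC //; lia.
Qed.

(** The terms q_(m + b) with b > 0 have adjoints that kill h. *)
Lemma hall_vertex m f h : (forall b, (m < b)%N -> skew 1 b h = 0) ->
  hall (vertex m f) h = hall f (skew 1 m h).
Proof.
move=> h0; have [N fN] := skew_eq0 (-1) f.
rewrite (@vertexE N.+1) => [|a Na]; last by apply: fN; lia.
rewrite hall_sum big_ord_recl big1 ?addr0 => [|b _].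
  by rewrite hall_q skew0.
by rewrite hall_q h0 ?(hallC _ 0) ?hall0 //= /bump /=; lia.
Qed.

(** The norm b_la(t), in the form in which [skew_HLpart] produces it. *)
Fixpoint HLnorm (la : seq nat) : F :=
  if la is m :: la' then (1 - t ^+ count_mem m la) * HLnorm la' else 1.

(** By symmetry one may suppose la_1 >= mu_1; then [hall_vertex] removes la_1, and
    [skew_HLpart] removes mu_1 or shows that the product is 0. *)
Lemma hall_HLpart la mu : sorted geq la -> 0%N \notin la ->
    sorted geq mu -> 0%N \notin mu ->
  hall (HLpart la) (HLpart mu) = if la == mu then HLnorm la else 0.
Proof.
have main l la1 mu1 : sorted geq mu1 -> 0%N \notin mu1 -> (head 0 mu1 <= l)%N ->
    hall (HLpart (l :: la1)) (HLpart mu1) = hall (HLpart la1) (skew 1 l (HLpart mu1)).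
  move=> smu mu0 le; apply: hall_vertex => b lb.
  by apply: (skew_HLpart smu mu0).1; apply: leq_ltn_trans lb.
elim: la mu => [|l la IHla] mu sla la0 smu mu0.
  case: mu smu mu0 => [|m mu] smu mu0; first by rewrite hall11.
  rewrite hallC main // /HLpart [HLtuple [::]]/(1 : V) skew1.
  by move: mu0; rewrite inE eq_sym negb_or => /andP[/negPf-> _]; rewrite hallC hall0.
case: (leqP (head 0 mu) l) => [le|lt]; last first.
  case: mu smu mu0 lt => // m mu smu mu0 /= lt.
  rewrite hallC main //=; last exact: ltnW.
  rewrite (skew_HLpart sla la0).1 // hallC hall0 ifF //.
  by apply/eqP => -[E _]; rewrite E ltnn in lt.
rewrite main //; move: le; rewrite leq_eqVlt => /orP[/eqP E|lt]; last first.
  rewrite (skew_HLpart smu mu0).1 // hallC hall0 ifF //.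
  by apply/eqP => E; rewrite -E /= ltnn in lt.
case: mu smu mu0 E => [|m mu] smu mu0 /= E; first by move: la0; rewrite -E inE eqxx.
subst l; rewrite ((skew_HLpart smu mu0).2 _ _ erefl) hallZr IHla.
- by rewrite eqseq_cons /= eqxx /=; case: (la =P mu) => [->|_] //; rewrite mulr0.
- exact: path_sorted sla.
- by move: la0; rewrite inE negb_or => /andP[].
- exact: path_sorted smu.
- by move: mu0; rewrite inE negb_or => /andP[].
Qed.

(** * Raising operators *)

(** As q_n = 0 for n < 0, any upper bound for [x] may serve to truncate the sum. *)
Lemma sub_subst_qi N x : x <= N%:Z ->
  subst (fun i => (p i)%:P + (-1)%:A *: 'X^i) (qi x) =
  \sum_(c < N.+1) (raise_coef c *: qi (x - c%:Z))%:P * 'X^c.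
Proof.
move=> xN; apply/polyP => b; rewrite -/(skew (-1) b (qi x)) sub_skew_qi coef_sum.
under eq_bigr => c _ do rewrite coefCM coefXn mulr_natr mulrb.
rewrite -big_mkcond /=; case: (leqP b N) => bN.
  by rewrite (big_pred1 (Ordinal (bN : (b < N.+1)%N))).
rewrite big1 => [|c /eqP bc]; first by rewrite qi_neg ?scaler0 //; lia.
by have := ltn_ord c; lia.
Qed.

(** Expanding the product of the substituted q's gives one term for each choice of
    the exponents c_i, which become the first row of the exponents of the raising
    operators. *)
Lemma vertex_prod_qi l N a (ga : 'I_l -> int) :
    (forall i, ga i <= N%:Z) ->
  vertex a (\prod_i qi (ga i)) = \sum_(c : {ffun 'I_l -> 'I_N.+1})
    (\prod_i raise_coef (c i)) *:
      (qi (a + \sum_i (c i)%:Z) * \prod_i qi (ga i - (c i)%:Z)).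
Proof.
move=> gaN.
have skewE b : skew (-1) b (\prod_i qi (ga i)) =
    \sum_(c : {ffun 'I_l -> 'I_N.+1} | b == (\sum_i c i)%N)
      (\prod_i raise_coef (c i)) *: \prod_i qi (ga i - (c i)%:Z).
  rewrite /skew rmorph_prod /=; under eq_bigr => i _ do rewrite (sub_subst_qi (gaN i)).
  rewrite bigA_distr_bigA /= coef_sum [RHS]big_mkcond; apply: eq_bigr => c _.
  rewrite big_split /= -rmorph_prod /= prodrXr coefCM coefXn mulr_natr mulrb.
  by rewrite scaler_prod.
rewrite (@vertexE (l * N).+1) => [|b lb]; last first.
  rewrite skewE big1 // => c /eqP bc; suff: (b <= l * N)%N by lia.
  rewrite bc (leq_trans (leq_sum _ (fun i _ => leq_ord (c i)))) //.
  by rewrite sum_nat_const card_ord.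
under [LHS]eq_bigr => b _ do rewrite skewE mulr_sumr.
rewrite (exchange_big_dep xpredT) //=; apply: eq_bigr => c _.
have lb : (\sum_i c i < (l * N).+1)%N.
  rewrite ltnS (leq_trans (leq_sum _ (fun i _ => leq_ord (c i)))) //.
  by rewrite sum_nat_const card_ord.
rewrite (big_pred1 (Ordinal lb)) //= -scalerAr; congr (_ *: (qi (_ + _) * _)).
exact: (big_morph Posz PoszD).
Qed.

(** The index of the i-th factor q after the raising operators have acted. *)
Definition raised l (al : seq int) (k : 'I_l -> 'I_l -> nat) (i : 'I_l) : int :=
  al`_i + \sum_j (k i j)%:Z - \sum_j (k j i)%:Z.

Definition raising_term l (al : seq int) (k : 'I_l -> 'I_l -> nat) : V :=
  (\prod_(i < l) \prod_(j < l | (i < j)%N) raise_coef (k i j)) *: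
    \prod_i qi (raised al k i).

Definition upper l (T : eqType) (z : T) (k : 'M[T]_l) :=
  [forall i : 'I_l, forall j : 'I_l, (j <= i)%N ==> (k i j == z)].

(** A strictly upper triangular matrix of size l + 1 is its first row, without the
    diagonal entry, together with one of size l. *)
Definition cons_mx l T (z : T) (ck : {ffun 'I_l -> T} * 'M[T]_l) : 'M[T]_l.+1 :=
  \matrix_(i, j) if unlift ord0 j is Some j' then
    if unlift ord0 i is Some i' then ck.2 i' j' else ck.1 j' else z.

Definition uncons_mx l T (k : 'M[T]_l.+1) : {ffun 'I_l -> T} * 'M[T]_l :=
  ([ffun j => k ord0 (lift ord0 j)], \matrix_(i, j) k (lift ord0 i) (lift ord0 j)).

Lemma cons_mx00 l T z ck : @cons_mx l T z ck ord0 ord0 = z.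
Proof. by rewrite mxE unlift_none. Qed.
Lemma cons_mxS0 l T z ck i : @cons_mx l T z ck (lift ord0 i) ord0 = z.
Proof. by rewrite mxE unlift_none. Qed.
Lemma cons_mx0S l T z ck j : @cons_mx l T z ck ord0 (lift ord0 j) = ck.1 j.
Proof. by rewrite mxE liftK unlift_none. Qed.
Lemma cons_mxSS l T z ck i j :
  @cons_mx l T z ck (lift ord0 i) (lift ord0 j) = ck.2 i j.
Proof. by rewrite mxE !liftK. Qed.
Definition cons_mxE := (cons_mx00, cons_mxS0, cons_mx0S, cons_mxSS).

Lemma cons_mxK l T (z : T) : cancel (@cons_mx l T z) (@uncons_mx l T).
Proof.
case=> c k; congr (_, _); first by apply/ffunP => j; rewrite ffunE cons_mxE.
by apply/matrixP => i j; rewrite mxE cons_mxE.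
Qed.

Lemma ordS_ind l (P : 'I_l.+1 -> Prop) :
  P ord0 -> (forall i, P (lift ord0 i)) -> forall i, P i.
Proof. by move=> P0 PS i; case: (unliftP ord0 i) => [j|] ->. Qed.

Lemma uncons_mxK l (T : eqType) (z : T) (k : 'M[T]_l.+1) :
  upper z k -> cons_mx z (uncons_mx k) = k.
Proof.
move=> up; have k0 (i j : 'I_l.+1) : (j <= i)%N -> k i j = z.
  by move=> ji; have /forallP/(_ i)/forallP/(_ j)/implyP/(_ ji)/eqP := up.
apply/matrixP; elim/ordS_ind => [|i]; elim/ordS_ind => [|j];
  rewrite cons_mxE ?mxE ?ffunE //; by rewrite k0.
Qed.

Lemma upper_cons_mx l (T : eqType) (z : T) ck :
  upper z (@cons_mx l T z ck) = upper z ck.2.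
Proof.
apply/forallP/forallP => up i.
  apply/forallP => j; have /forallP/(_ (lift ord0 j)) := up (lift ord0 i).
  by rewrite cons_mxE /= /bump /= !add1n ltnS.
elim/ordS_ind: i => [|i]; apply/forallP; elim/ordS_ind => [|j];
  rewrite !cons_mxE ?eqxx ?implybT //.
by rewrite /= /bump /= !add1n ltnS; have /forallP := up i.
Qed.

Lemma sum_raised l al (k : 'I_l -> 'I_l -> nat) : size al = l ->
  \sum_i raised al k i = \sum_(x <- al) x.
Proof.
move=> sal; rewrite sumrB big_split /= [X in _ + X - _]exchange_big addrK.
by rewrite (big_nth 0) sal big_mkord.
Qed.

Lemma raising_term_cons l N x al (ck : {ffun 'I_l -> 'I_N.+1} * 'M['I_N.+1]_l) :
  raising_term (x :: al) (fun i j => cons_mx ord0 ck i j) =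
  (\prod_(i < l) \prod_(j < l | (i < j)%N) raise_coef (ck.2 i j)) *:
    ((\prod_i raise_coef (ck.1 i)) *: (qi (x + \sum_i (ck.1 i)%:Z) *
      \prod_i qi (raised al (fun i j => ck.2 i j) i - (ck.1 i)%:Z))).
Proof.
rewrite /raising_term scalerA; congr (_ *: _).
  rewrite big_ord_recl mulrC; congr (_ * _).
    apply: eq_bigr => i _; rewrite big_mkcond big_ord_recl /= mul1r [RHS]big_mkcond.
    by apply: eq_bigr => j _; rewrite cons_mxE /bump /= !add1n ltnS.
  rewrite big_mkcond big_ord_recl /= mul1r.
  by apply: eq_bigr => j _; rewrite cons_mxE.
rewrite big_ord_recl; congr (qi _ * _).
  rewrite /raised big_ord_recl /= cons_mxE add0r.
  rewrite [X in _ - X]big1 ?subr0 => [|i _]; last first.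
    by elim/ordS_ind: i => [|i]; rewrite cons_mxE.
  by congr (_ + _); apply: eq_bigr => j _; rewrite cons_mxE.
apply: eq_bigr => i _; rewrite /raised !big_ord_recl /= !cons_mxE add0r.
rewrite opprD -!addrA; congr (qi (_ + (_ + _))).
  by apply: eq_bigr => j _; rewrite cons_mxE.
rewrite addrC; congr (_ - _); by apply: eq_bigr => j _; rewrite cons_mxE.
Qed.

(** The bound [N] need not grow with the size: if all indices [raised] are
    nonnegative, each is at most their sum, which is the sum of [al]; otherwise the
    term is 0, and stays 0 after the next vertex operator has lowered its indices. *)
Lemma HLtuple_expand N al : (\sum_(x <- al) absz x <= N)%N ->
  HLtuple al = \sum_(k : 'M['I_N.+1]_(size al) | upper ord0 k)
    raising_term al (fun i j => k i j).
Proof.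
elim: al => [|x al IHal].
  move=> _; rewrite (big_pred1 (\matrix_(i, j) ord0)) => [|k].
    by rewrite /raising_term !big_ord0 scale1r.
  rewrite /= [RHS](_ : _ = true); last by apply/eqP/matrixP => -[].
  by apply/forallP => -[].
rewrite big_cons => alN; have {}alN : (\sum_(x <- al) absz x <= N)%N by lia.
have -> : HLtuple (x :: al) = vertex x (HLtuple al) by [].
rewrite IHal // linear_sum.
rewrite [RHS](reindex_onto (@cons_mx _ _ ord0) (@uncons_mx _ _)) => [|k]; last first.
  exact: uncons_mxK.
under [RHS]eq_bigl => ck do rewrite upper_cons_mx cons_mxK eqxx andbT.
rewrite -(pair_big_dep xpredT (fun _ k => upper ord0 k)
  (fun c k => raising_term (x :: al) (fun i j => cons_mx ord0 (c, k) i j))) /=.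
rewrite [RHS]exchange_big /=; apply: eq_bigr => k _.
under eq_bigr => c _ do rewrite raising_term_cons /=.
rewrite linearZ /= -scaler_sumr; congr (_ *: _).
case: (boolP [forall i : 'I_(size al), 0 <= raised al (fun i j => k i j) i]).
  move=> /forallP ge0.
  apply: vertex_prod_qi => i.
  have := @sum_raised _ al (fun i j => k i j) erefl.
  rewrite (bigD1 i) //= => sumE.
  have le1 : raised al (fun i j => k i j) i <= \sum_(y <- al) y.
    by rewrite -sumE lerDl; apply: sumr_ge0 => j _.
  apply: le_trans le1 _; apply: (@le_trans _ _ (\sum_(y <- al) absz y)%N%:Z).
    rewrite (big_morph Posz PoszD (erefl (Posz 0))); apply: ler_sum => y _.
    by rewrite abszE ler_norm.
  by rewrite lez_nat.
rewrite negb_forall => /existsP[i]; rewrite -ltNge => lt0.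
rewrite (bigD1 i) //= qi_neg // mul0r linear0 big1 // => c _.
rewrite [X in _ *: (_ * X)](_ : _ = 0) ?mulr0 ?scaler0 // (bigD1 i) //= qi_neg ?mul0r //.
by apply: le_lt_trans lt0; rewrite lerBlDr lerDl.
Qed.
(** The indices from row [i0] on sum to the sum of the corresponding entries of [al]
    minus all the exponents k j i with j < i0 <= i, since the other exponents
    cancel. Hence only finitely many exponents give a nonzero term. *)
Lemma raised_ge0_bound l al (k : 'I_l -> 'I_l -> nat) i0 j0 :
    size al = l -> (forall i j : 'I_l, (j <= i)%N -> k i j = 0%N) ->
    (forall i, 0 <= raised al k i) ->
  (k j0 i0 <= \sum_(x <- al) absz x)%N.
Proof.
move=> sal kup ge0.
have [le|lt] := leqP i0 j0; first by rewrite kup.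
pose P (i : 'I_l) := (i0 <= i)%N.
have : 0 <= \sum_(i | P i) raised al k i by apply: sumr_ge0.
rewrite /raised sumrB big_split /=.
have -> : \sum_(i | P i) \sum_j (k i j)%:Z = \sum_(j | P j) \sum_(i | P i) (k i j)%:Z.
  rewrite (exchange_big_dep xpredT) //= (bigID P) /= [X in _ + X]big1 ?addr0.
    by apply: eq_bigr => j _; apply: eq_bigl => i; rewrite andbT.
  move=> j; rewrite /P -ltnNge => ji0; apply: big1 => i /andP[i0i _].
  by rewrite kup // (leq_trans (ltnW ji0)).
have -> : \sum_(i | P i) \sum_j (k j i)%:Z =
    \sum_(i | P i) \sum_(j | P j) (k j i)%:Z + \sum_(i | P i) \sum_(j | ~~ P j) (k j i)%:Z.
  by rewrite -big_split; apply: eq_bigr => i _; rewrite [LHS](bigID P).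
rewrite opprD addrA addrK subr_ge0 => le.
rewrite -lez_nat (big_morph Posz PoszD (erefl (Posz 0))).
apply: (@le_trans _ _ (\sum_(i | P i) al`_i)).
  apply: le_trans le; rewrite (bigD1 i0) /P ?leqnn //= (bigD1 j0) -?ltnNge //=.
  rewrite -addrA lerDl; apply: addr_ge0.
    exact: sumr_ge0.
  by apply: sumr_ge0 => i _; apply: sumr_ge0.
rewrite (big_nth 0) sal big_mkord [X in _ <= X](bigID P) /=.
rewrite -[X in X <= _]addr0; apply: lerD; last exact: sumr_ge0.
by apply: ler_sum => i _; rewrite abszE ler_norm.
Qed.

Lemma HLpart_fsum la :
  HLpart la =
  \sum_(k \in [set k : 'M[nat]_(size la) |
                 forall i j : 'I_(size la), (j <= i)%N -> k i j = 0%N])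
    (\prod_(i < size la) \prod_(j < size la | (i < j)%N) raise_coef (k i j)) *:
    \prod_(i < size la)
      qi ((nth 0%N la i)%:Z + \sum_(j < size la) (k i j)%:Z
                             - \sum_(j < size la) (k j i)%:Z).
Proof.
pose al := map Posz la; pose N := (\sum_(x <- al) absz x)%N.
have sal : size al = size la by rewrite size_map.
have nth_al (i : 'I_(size la)) : al`_i = (nth 0%N la i)%:Z.
  by rewrite (nth_map 0%N).
pose nat_mx (k : 'M['I_N.+1]_(size la)) : 'M[nat]_(size la) := map_mx (@nat_of_ord _) k.
pose r := [seq nat_mx k | k <- enum [pred k : 'M['I_N.+1]_(size la) | upper ord0 k]].
have inj : injective nat_mx.
  move=> k k' /matrixP E; apply/matrixP => i j; apply: val_inj.
  by have := E i j; rewrite !mxE.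
rewrite (@fsbigE _ _ _ _ _ r).
- rewrite big_mkcond big_map -big_mkcond big_enum_cond /=.
  rewrite /HLpart -/al (@HLtuple_expand N) // sal.
  apply: eq_big => [k|k _].
    rewrite inE; case: (boolP (upper _ k)) => //= /forallP up; apply/esym/mem_set.
    move=> i j ji /=; rewrite mxE.
    by have /forallP/(_ j)/implyP/(_ ji)/eqP -> := up i.
  rewrite /raising_term; congr (_ *: _).
    by apply: eq_bigr => i _; apply: eq_bigr => j _; rewrite mxE.
  apply: eq_bigr => i _; rewrite /raised nth_al; congr (qi (_ + _ - _));
    by apply: eq_bigr => j _; rewrite mxE.
- by rewrite map_inj_uniq // enum_uniq.
- move=> k /= /mapP[k']; rewrite mem_enum => /forallP up -> i j ji.
  by rewrite mxE; have /forallP/(_ j)/implyP/(_ ji)/eqP -> := up i.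
move=> k /= kup kr.
suff [i lt0] : exists i, raised al (fun i j => k i j) i < 0.
  by rewrite [X in _ *: X](_ : _ = 0) ?scaler0 // (bigD1 i) //= -nth_al qi_neg ?mul0r.
apply/existsP; apply: contraNT kr; rewrite negb_exists => /forallP ge0.
have kN i j : (k j i < N.+1)%N.
  rewrite ltnS; apply: (@raised_ge0_bound _ al (fun i j => k i j)) => // i1.
  by rewrite leNgt ge0.
apply/mapP; exists (\matrix_(i, j) inord (k i j)); last first.
  by apply/matrixP => i j; rewrite !mxE inordK.
rewrite mem_enum; apply/forallP => i; apply/forallP => j; apply/implyP => ji.
by rewrite mxE kup //; apply/eqP/val_inj; rewrite /= inordK.
Qed.
(** * Coordinates with respect to the dual basis *)
Lemma hall_pM_HLpart m la f : (0 < m)%N ->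
  hall (HLpart la) (p m * f) =
  \sum_(j < size la) hall (HLtuple (sub_at m%:Z j (map Posz la))) f.
Proof.
move=> m0; rewrite hallC hall_p // hallC padj_HLtuple // hall_sum size_map.
by [].
Qed.

Lemma HLnorm_neq0 la : HLnorm la != 0.
Proof.
elim: la => [|m la IHla]; first exact: oner_neq0.
by rewrite mulf_neq0 // tX_neq1 //= eqxx.
Qed.

(** An infinite support would make the sum 0 by convention, contrary to f <> 0. So
    the sum is finite, and pairing it with [HLpart la] leaves one term. *)
Lemma hall_coordinates (x : seq nat -> F) (f : V) : f != 0 ->
    f = \sum_(la \in [set la | sorted geq la && (0%N \notin la)])
          x la *: ((HLnorm la)^-1 *: HLpart la) ->
  forall la, sorted geq la && (0%N \notin la) -> x la = hall (HLpart la) f.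
Proof.
move=> f0 Ef la la_part; have /andP[sla la0] := la_part.
have HLla : HLpart la != 0.
  apply: contraTneq isT => E; have := hall_HLpart sla la0 sla la0.
  by rewrite eqxx E hall0 => /esym/eqP; rewrite (negPf (HLnorm_neq0 la)).
move: Ef; case: finite_supportP => [_|L Lpart L0 _] Ef.
  by rewrite Ef big_nil eqxx in f0.
rewrite Ef hallC hall_sum.
under eq_big_seq => mu muL.
  have /andP[smu mu0] := Lpart mu muL.
  rewrite !hallZ hall_HLpart //.
  over.
have [laL|laL] := boolP (la \in L).
  rewrite (bigD1_seq la) ?fset_uniq //= eqxx mulVf ?HLnorm_neq0 // mulr1.
  by rewrite big1 ?addr0 // => mu /negPf ->; rewrite !mulr0.
rewrite big_seq big1 => [|mu muL]; last first.
  by rewrite ifF ?mulr0 //; apply: contraNF laL => /eqP <-.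
have /eqP := L0 la la_part laL.
by rewrite !scaler_eq0 invr_eq0 (negPf (HLnorm_neq0 la)) (negPf HLla) !orbF => /eqP.
Qed.
End HallLittlewood.

(** * The algebra of power sums *)

Lemma fact_exprS (F : fieldType) n (c : F) :
  (1 + n)`!%:R * c ^+ (1 + n) = n.+1%:R * c * (n`!%:R * c ^+ n).
Proof. by rewrite add1n factS natrM exprS mulrACA. Qed.

Lemma scaler_succ (F : fieldType) (W : lmodType F) n (c : F) (x y : W) :
  n = 0%N \/ x = y -> (n%:R * c) *: x + c *: y = ((1 + n)%:R * c) *: y.
Proof.
by case=> ->; rewrite ?mul0r ?scale0r ?add0r ?mul1r // addrC natrD mulrDl mul1r scalerDl.
Qed.

Lemma cmonom_ind (P : {cmonom nat} -> Prop) :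
  P mone -> (forall i m, P m -> P (mmul (ucm i) m)) -> forall m, P m.
Proof.
move=> P1 PM m; have [n] := ubnP (mdeg m); elim: n m => // n IHn m lemn.
have [->|m1] := eqVneq m mone; first exact: P1.
have /fset0Pn[i im] : finsupp m != fset0.
  apply/eqP => m0; case/eqP: m1; apply/mdeg_eq0I.
  by rewrite mdegE m0 big_seq_fset0.
have Em : m = mmul (ucm i) (divcm m (ucm i)).
  apply/eqP/cmP => j; rewrite cmM divcmE cmU.
  have [<-|_] := eqVneq i j; last by rewrite subn0.
  by rewrite subnKC // lt0n cmE_neq0.
rewrite Em; apply: PM; apply: IHn; move: lemn.
by rewrite {1}Em mdegM mdegU.
Qed.

Section Evaluation.
Variables (S : comNzRingType) (g : nat -> S).

Definition cmeval (x : {cmonom nat}) : S := \prod_(i <- finsupp x) g i ^+ x i.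

Lemma cmevalEw (d : {fset nat}) (x : {cmonom nat}) : (finsupp x `<=` d)%fset ->
  cmeval x = \prod_(i <- d) g i ^+ x i.
Proof.
move=> le; rewrite /cmeval (big_fset_incl _ le) // => i _.
by rewrite -cmE_eq0 => /eqP ->; rewrite expr0.
Qed.

Lemma cmeval_morph : mmorphism cmeval.
Proof.
split=> [x y|]; last by rewrite /cmeval mdom1 big_seq_fset0.
rewrite (@cmevalEw (finsupp x `|` finsupp y)%fset (mmul x y)) ?mdomD //.
rewrite (@cmevalEw (finsupp x `|` finsupp y)%fset x) ?fsubsetUl //.
rewrite (@cmevalEw (finsupp x `|` finsupp y)%fset y) ?fsubsetUr //.
by rewrite -big_split; apply: eq_bigr => i _; rewrite cmM exprD.
Qed.
Lemma cmevalU i : cmeval (ucm i) = g i.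
Proof. by rewrite /cmeval mdomU big_seq_fset1 cmUU expr1. Qed.

HB.instance Definition _ := isMultiplicative.Build _ _ cmeval cmeval_morph.
End Evaluation.

Section PowerSumAlgebra.
Variable F : fieldType.

(** The variable of index i is p_(i + 1). *)
Definition psalg : comAlgType F := {malg F[{cmonom nat}]}.
Local Notation V := psalg.
Definition pwsum (n : nat) : V := mkmalgU (ucm n.-1) 1.

Section Substitution.
Variable g : nat -> {poly V}.

Definition subst_fun (f : V) : {poly V} :=
  mmap (polyC \o in_alg V) (cmeval (fun i => g i.+1)) f.

Fact subst_fun_additive : additive subst_fun.
Proof. exact: raddfB. Qed.
HB.instance Definition _ :=
  GRing.isAdditive.Build V {poly V} subst_fun subst_fun_additive.

Fact subst_fun_multiplicative : multiplicative subst_fun.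
Proof. by split; [exact: rmorphM | exact: rmorph1]. Qed.
HB.instance Definition _ :=
  GRing.isMultiplicative.Build V {poly V} subst_fun subst_fun_multiplicative.

Definition psubst : {rmorphism V -> {poly V}} := subst_fun.

Lemma psubst_psum k : (0 < k)%N -> psubst (pwsum k) = g k.
Proof.
case: k => // k _.
by rewrite /= /subst_fun /pwsum mmapU /= scale1r mul1r cmevalU.
Qed.

Lemma psubstZ c f : psubst (c *: f) = c%:A%:P * psubst f.
Proof. by rewrite /= /subst_fun mmapZ. Qed.

End Substitution.

Definition monom (m : {cmonom nat}) : V := mkmalgU m 1.
Definition pcoef (m : {cmonom nat}) (f : V) : F := f@_m.

Lemma monom1 : monom mone = 1.
Proof. exact: mpolyC1E. Qed.

Lemma pcoef_monom m m' : pcoef m' (monom m) = (m == m')%:R.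
Proof. exact: mcoeffU1. Qed.

Lemma pcoefD m f h : pcoef m (f + h) = pcoef m f + pcoef m h.
Proof. exact: mcoeffD. Qed.

Lemma pcoefZ m c f : pcoef m (c *: f) = c * pcoef m f.
Proof. exact: mcoeffZ. Qed.

Lemma psumM_monom i (m : {cmonom nat}) :
  pwsum i.+1 * monom m = monom (mmul (ucm i) m).
Proof. by rewrite /monom /pwsum /= malgM_def fgmulUU mulr1. Qed.

Lemma monomZ (m : {cmonom nat}) (c : F) : mkmalgU m c = c *: monom m.
Proof.
by rewrite /monom -mul_malgC malgM_def fgmulUU mul1m mulr1.
Qed.

Lemma monom_ind (P : V -> Prop) :
  (forall m, P (monom m)) -> (forall f h, P f -> P h -> P (f + h)) ->
  (forall c f, P f -> P (c *: f)) -> forall f, P f.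
Proof.
move=> Pm PD PZ f; rewrite (monalgE f); apply: big_ind.
- by rewrite -(scale0r (monom mone)); apply: PZ.
- exact: PD.
by move=> m _; rewrite monomZ; apply: PZ.
Qed.

Lemma functional_ext (phi psi : V -> F) :
  (forall f h, phi (f + h) = phi f + phi h) ->
  (forall c f, phi (c *: f) = c * phi f) ->
  (forall f h, psi (f + h) = psi f + psi h) ->
  (forall c f, psi (c *: f) = c * psi f) ->
  (forall m, phi (monom m) = psi (monom m)) -> phi =1 psi.
Proof.
move=> phiD phiZ psiD psiZ eq_monom; apply: monom_ind => // [f h Ef Eh|c f Ef].
- by rewrite phiD psiD Ef Eh.
- by rewrite phiZ psiZ Ef.
Qed.

Lemma psum_ind (P : V -> Prop) :
  P 1 -> (forall f h, P f -> P h -> P (f + h)) -> (forall c f, P f -> P (c *: f)) ->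
  (forall k f, (0 < k)%N -> P f -> P (pwsum k * f)) -> forall f, P f.
Proof.
move=> P1 PD PZ PM; apply: (monom_ind _ PD PZ) => m.
elim/cmonom_ind: m => [|i m IHm]; first by rewrite monom1.
by rewrite -psumM_monom; apply: PM.
Qed.
Variable t : F.
Local Notation pdiff := (padj t pwsum psubst).

Lemma divcmK i (m : {cmonom nat}) : divcm (mmul (ucm i) m) (ucm i) = m.
Proof. by apply/eqP/cmP => x; rewrite divcmE cmM addKn. Qed.

Lemma mulcmK i (m : {cmonom nat}) : m i != 0%N -> mmul (ucm i) (divcm m (ucm i)) = m.
Proof.
move=> mi; apply/eqP/cmP => x; rewrite cmM divcmE cmU.
by have [<-|_] := eqVneq i x; rewrite ?subn0 // subnKC // lt0n.
Qed.

Lemma pdiff_monom i (m : {cmonom nat}) :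
  pdiff i.+1 (monom m) =
  ((m i)%:R * pnorm t i.+1) *: monom (divcm m (ucm i)).
Proof.
elim/cmonom_ind: m => [|j m IHm].
  by rewrite monom1 padj1 cm1 mul0r scale0r.
rewrite -psumM_monom (padj_pM t psum_ind psubst_psum psubstZ i.+1 _ (ltn0Sn j)).
rewrite IHm -scalerAr psumM_monom cmM cmU eqSS.
have [->|ji] := eqVneq j i.
  rewrite divcmK; have : m i = 0%N \/ mmul (ucm i) (divcm m (ucm i)) = m.
    by have [|/mulcmK] := eqVneq (m i) 0%N; [left | right].
  move=> H; apply: scaler_succ; case: H => ->; [by left | by right].
have -> : mmul (ucm j) (divcm m (ucm i)) = divcm (mmul (ucm j) m) (ucm i).
  apply/eqP/cmP => x; rewrite cmM !divcmE cmM !cmU.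
  by have [<-|_] := eqVneq i x; rewrite ?(negPf ji) ?subn0.
exact: addr0.
Qed.

(** z_lambda(t), where the monomial [m] is p_lambda. *)
Definition zee (m : {cmonom nat}) : F :=
  \prod_(i <- finsupp m) ((m i)`!%:R * pnorm t i.+1 ^+ m i).

Lemma zeeM i (m : {cmonom nat}) :
  zee (mmul (ucm i) m) = (m i).+1%:R * pnorm t i.+1 * zee m.
Proof.
have zeeEw (d : {fset nat}) (x : {cmonom nat}) : (finsupp x `<=` d)%fset ->
    zee x = \prod_(i <- d) ((x i)`!%:R * pnorm t i.+1 ^+ x i).
  move=> le; rewrite /zee (big_fset_incl _ le) // => j _.
  by rewrite -cmE_eq0 => /eqP ->; rewrite fact0 expr0 mulr1.
pose d := (i |` finsupp m)%fset.
rewrite (zeeEw d (mmul _ m)) ?(zeeEw d m) ?fsubsetUr //; last by rewrite mdomD mdomU.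
rewrite [LHS](big_fsetD1 i) ?fset1U1 //=.
rewrite [X in _ = _ * X](big_fsetD1 i) ?fset1U1 //= mulrA; congr (_ * _).
  by rewrite cmM cmUU; exact: fact_exprS.
rewrite !big_seq; apply: eq_bigr => j; rewrite in_fsetD1 => /andP[ji _].
by rewrite cmM cmU eq_sym (negPf ji) add0n.
Qed.

Definition hall (f h : V) : F :=
  \sum_(m <- msupp f) pcoef m f * pcoef m h * zee m.

Lemma hallEw (d : {fset {cmonom nat}}) f h : (msupp f `<=` d)%fset ->
  hall f h = \sum_(m <- d) pcoef m f * pcoef m h * zee m.
Proof.
move=> le; rewrite /hall (big_fset_incl _ le) // => j _.
by rewrite /pcoef => /mcoeff_outdom ->; rewrite !mul0r.
Qed.

Lemma hallC f h : hall f h = hall h f.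
Proof.
rewrite (@hallEw (msupp f `|` msupp h)%fset) ?fsubsetUl //.
rewrite (@hallEw (msupp f `|` msupp h)%fset h) ?fsubsetUr //.
by apply: eq_bigr => m _; rewrite [pcoef m h * _]mulrC.
Qed.

Lemma hallD f g h : hall (f + g) h = hall f h + hall g h.
Proof.
pose d := (msupp f `|` msupp g)%fset.
rewrite (@hallEw d (f + g)) ?msuppD_le // (@hallEw d f) ?fsubsetUl //.
rewrite (@hallEw d g) ?fsubsetUr // -big_split; apply: eq_bigr => m _ /=.
by rewrite pcoefD !mulrDl.
Qed.

Lemma hallZ c f h : hall (c *: f) h = c * hall f h.
Proof.
rewrite (@hallEw (msupp f)) ?msuppZ_le // mulr_sumr; apply: eq_bigr => m _.
by rewrite pcoefZ !mulrA.
Qed.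

Lemma hall_monom (m : {cmonom nat}) h : hall (monom m) h = pcoef m h * zee m.
Proof.
by rewrite /hall /monom msuppU oner_eq0 big_seq_fset1 pcoef_monom eqxx mul1r.
Qed.

(** Both sides are linear in h, and on monomials [pdiff_monom] applies. *)
Lemma pdiff_coef i h (m : {cmonom nat}) :
  pcoef m (pdiff i.+1 h) = (m i).+1%:R * pnorm t i.+1 * pcoef (mmul (ucm i) m) h.
Proof.
move: h; apply: functional_ext => [f h|c f|f h|c f|y].
- by rewrite (@padjD _ t _ pwsum psubst psubstZ i.+1 f h) pcoefD.
- by rewrite (@padjZ _ t _ pwsum psubst psubstZ i.+1 c f) pcoefZ.
- by rewrite pcoefD mulrDr.
- by rewrite pcoefZ mulrCA.
rewrite pdiff_monom pcoefZ !pcoef_monom.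
have [->|neq] := eqVneq y (mmul (ucm i) m).
  by rewrite divcmK eqxx cmM cmUU.
have [->|yi] := eqVneq (y i) 0%N; first by rewrite !mul0r mulr0.
case: eqP => [E|_]; last by rewrite !mulr0.
by case/eqP: neq; rewrite -E mulcmK.
Qed.

Lemma hall_psum k f h : (0 < k)%N -> hall (pwsum k * f) h = hall f (pdiff k h).
Proof.
case: k => // i _; move: f; apply: functional_ext => [f g|c f|f g|c f|m].
- by rewrite mulrDr hallD.
- by rewrite -scalerAr hallZ.
- exact: hallD.
- exact: hallZ.
rewrite psumM_monom.
apply: etrans (hall_monom _ _) (etrans _ (esym (hall_monom _ _))).
rewrite zeeM pdiff_coef.
by rewrite mulrA [pcoef _ h * _]mulrC.
Qed.

Lemma hall11 : hall 1 1 = 1.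
Proof.
by rewrite -monom1 hall_monom pcoef_monom eqxx mul1r /zee mdom1 big_seq_fset0.
Qed.

End PowerSumAlgebra.

(** * Sequences of straightening operations *)

Lemma ascentP al i : ascent al i -> exists u x y v,
  [/\ al = u ++ [:: x, y & v], size u = i, x < y, gap al i = absz (y - x) &
      forall a, Sop (i, a) al = u ++ [:: y - a%:Z, x + a%:Z & v]].
Proof.
case/andP=> ltial ltxy; set x := al`_i in ltxy; set y := al`_i.+1 in ltxy.
exists (take i al), x, y, (drop i.+2 al); set u := take i al; set v := drop _ _.
have su : size u = i by rewrite size_takel // ltnW // ltnW.
have Eal : al = u ++ [:: x, y & v].
  by rewrite -[LHS](cat_take_drop i) (drop_nth 0) ?(drop_nth 0 ltial) // ltnW.
split=> // a; rewrite /Sop -/x -/y {1}Eal -{}su; elim: u {Eal} => //= z u ->.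
by [].
Qed.

Lemma Sop_sum al i a : ascent al i ->
  \sum_(x <- Sop (i, a) al) x = \sum_(x <- al) x.
Proof.
case/ascentP=> u [x [y [v [-> _ _ _ ->]]]].
by rewrite !big_cat !big_cons /=; ring.
Qed.

(** The sum of i (al_i + M), written as the sum over the proper suffixes; a
    straightening operation moves a positive amount one position to the left. *)
Fixpoint weight (M : int) (al : seq int) : int :=
  if al is x :: al' then \sum_(y <- al') (y + M) + weight M al' else 0.

Lemma weight_ge0 M al : all (fun x => 0 <= x + M) al -> 0 <= weight M al.
Proof.
elim: al => //= x al IHal /andP[_ al0]; rewrite addr_ge0 ?IHal // big_seq.
by apply: sumr_ge0 => y /(allP al0).
Qed.

(** No operation goes below the least entry, so that the weight stays nonnegative
    ([weight_ge0]); as it decreases, straightening terminates. *)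
Lemma weight_Sop M al i a : ascent al i -> (a <= (gap al i)./2)%N ->
    all (fun x => 0 <= x + M) al ->
  weight M (Sop (i, a) al) < weight M al /\
  all (fun x => 0 <= x + M) (Sop (i, a) al).
Proof.
case/ascentP=> u [x [y [v [-> su ltxy -> ->]]]] lea alM.
have {}lea : x + a%:Z < y by lia.
split; last first.
  by move: alM; rewrite !all_cat /= => /and4P[-> x0 y0 ->] /=; lia.
elim: u {su alM} => [|z u IHu] /=.
  by rewrite !big_cons; lia.
have -> : \sum_(y0 <- u ++ [:: y - a%:Z, x + a%:Z & v]) (y0 + M) =
          \sum_(y0 <- u ++ [:: x, y & v]) (y0 + M).
  by rewrite !big_cat !big_cons /=; ring.
by rewrite ltrD2l.
Qed.

Lemma Sseq_rcons s ia al : Sseq (rcons s ia) al = Sseq s (Sop ia al).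
Proof. by rewrite /Sseq foldr_rcons. Qed.

Lemma Sseq_coef_rcons s ia al :
  Sseq_coef (rcons s ia) al = Sop_coef ia al * Sseq_coef s (Sop ia al).
Proof.
elim: s => [|ib s IHs] /=; first by rewrite mulrC.
by rewrite IHs Sseq_rcons mulrCA.
Qed.

Lemma Sseq_follows_rcons sel s ia al : Sseq_follows sel (rcons s ia) al =
  [&& Sop_defined ia al, ia.1 == sel al & Sseq_follows sel s (Sop ia al)].
Proof.
elim: s => [|ib s IHs] /=; first by rewrite andbT.
by rewrite IHs Sseq_rcons -!andbA.
Qed.

Lemma Sseq_sum sel s al : Sseq_follows sel s al ->
  \sum_(x <- Sseq s al) x = \sum_(x <- al) x.
Proof.
elim: s => //= -[i a] s IHs /and3P[/IHs <- /andP[asc _] _].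
exact: Sop_sum.
Qed.

Lemma ascent_not_wd al i : ascent al i -> ~~ weakly_decreasing al.
Proof.
case/ascentP=> u [x [y [v [-> _ ltxy _ _]]]]; apply/negP.
rewrite /weakly_decreasing => /cat_sorted2[_] /=; lia.
Qed.

Section Straighten.
Variables (sel : seq int -> nat) (Q : seq int -> Qt).
Hypothesis hsel : straightening_rule sel.
Hypothesis Q_straighten : forall al i, ascent al i ->
  Q al = \sum_(a < (gap al i)./2.+1) Sop_coef (i, val a) al * Q (Sop (i, val a) al).

(** Induction on the weight. The rule determines the position of the first
    operation, which is the last entry of the list, so that each sequence occurs
    for exactly one choice of this operation. Weakly decreasing tuples admit no
    operation and have only the empty sequence. *)
Lemma straighten_list al : exists L : seq (seq (nat * nat)),
  [/\ uniq L,
      forall s, (s \in L) = Sseq_follows sel s al && weakly_decreasing (Sseq s al) &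
      Q al = \sum_(s <- L) Sseq_coef s al * Q (Sseq s al)].
Proof.
have [M alM] : exists M, all (fun x => 0 <= x + M) al.
  exists (\sum_(x <- al) `|x|); elim: al => //= x al IHal; rewrite big_cons.
  have ge0 : 0 <= \sum_(y <- al) `|y| by apply: sumr_ge0.
  apply/andP; split.
    by rewrite addrA addr_ge0 // -lerBlDl sub0r -normrN ler_norm.
  apply: sub_all IHal => y /= y0; apply: le_trans y0 _.
  by rewrite lerD2l lerDr.
have [n] := ubnP (absz (weight M al)); elim: n al alM => // n IHn al alM ltn.
have [wd|nwd] := boolP (weakly_decreasing al).
  exists [:: [::]]; split=> // [s|]; last by rewrite big_seq1 mul1r.
  rewrite inE; case/lastP: s => [|s ia]; first by rewrite eqxx wd.
  rewrite Sseq_follows_rcons /Sop_defined.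
  case: (boolP (ascent al ia.1)) => [/ascent_not_wd/negP[]//|_] /=.
  by case: s.
have asc := hsel nwd; set i := sel al in asc.
have step (a : 'I_(gap al i)./2.+1) : exists L : seq (seq (nat * nat)),
  [/\ uniq L,
      forall s, (s \in L) = Sseq_follows sel s (Sop (i, val a) al) &&
                   weakly_decreasing (Sseq s (Sop (i, val a) al)) &
      Q (Sop (i, val a) al) = \sum_(s <- L)
        Sseq_coef s (Sop (i, val a) al) * Q (Sseq s (Sop (i, val a) al))].
  have [ltw allw] := @weight_Sop M al i (val a) asc (leq_ord a) alM.
  apply: IHn => //; have := weight_ge0 alM; have := weight_ge0 allw; lia.
have [L HL] := fin_all_exists step.
exists [seq rcons s (i, val a) | a <- enum 'I_(gap al i)./2.+1, s <- L a]; split.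
- apply: allpairs_uniq_dep; first exact: enum_uniq.
    by move=> a _; case: (HL a).
  by move=> [a s] [b s'] _ _ /= /rcons_inj[-> /val_inj ->].
- move=> s; apply/allpairsPdep/idP => [[a [s' [_ s'L ->]]]|].
    have [_ Ls _] := HL a; rewrite Ls in s'L.
    rewrite Sseq_follows_rcons Sseq_rcons /Sop_defined asc /= eqxx.
    by rewrite -ltnS ltn_ord.
  case/lastP: s => [|s [j a]] /=; first by rewrite (negPf nwd).
  rewrite Sseq_follows_rcons Sseq_rcons /Sop_defined /=.
  move=> /andP[/and3P[/andP[_ lea] /eqP Ej fol] wd].
  rewrite -/i in Ej; rewrite {j}Ej in lea fol wd *.
  exists (Ordinal (lea : (a < (gap al i)./2.+1)%N)), s; split=> //.
    by rewrite mem_enum.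
  by have [_ -> _] := HL (Ordinal (lea : (a < (gap al i)./2.+1)%N)); rewrite fol.
rewrite (Q_straighten asc) big_allpairs_dep big_enum /=; apply: eq_bigr => a _.
have [_ _ ->] := HL a; rewrite mulr_sumr; apply: eq_bigr => s _.
by rewrite Sseq_coef_rcons Sseq_rcons mulrA.
Qed.

Hypothesis Q_neg : forall al, weakly_decreasing al ->
  ~~ all (fun x => 0 <= x) al -> Q al = 0.

Lemma straighten_fsum (m : int) al : \sum_(x <- al) x = m ->
  Q al = \sum_(s \in [set s : seq (nat * nat) |
      Sseq_follows sel s al /\ tuple_partition_of m (Sseq s al)])
    Sseq_coef s al * Q (Sseq s al).
Proof.
move=> sum_al; have [L [Lu LE ->]] := straighten_list al.
have sum_s s : Sseq_follows sel s al -> \sum_(x <- Sseq s al) x == m.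
  by move=> /Sseq_sum ->; apply/eqP.
rewrite (@fsbigE _ _ _ _ _ [seq s <- L | all (fun x => 0 <= x) (Sseq s al)]).
- rewrite big_filter_cond big_seq_cond [RHS]big_seq_cond big_mkcond [RHS]big_mkcond.
  apply: eq_bigr => s _; rewrite LE.
  case: (boolP (Sseq_follows sel s al)) => [fol|_] //=.
  case: (boolP (weakly_decreasing (Sseq s al))) => [wd|_] //=.
  case: (boolP (all _ _)) => [ge0|nge0] /=; last by rewrite Q_neg // mulr0.
  by rewrite mem_set //=; split=> //; rewrite /tuple_partition_of wd ge0 sum_s.
- exact: filter_uniq.
- move=> s /=; rewrite mem_filter LE => /and3P[ge0 fol wd]; split=> //.
  by rewrite /tuple_partition_of wd ge0 sum_s.
move=> s /= [fol /and3P[wd ge0 _]]; rewrite mem_filter ge0 LE fol wd //.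
Qed.
End Straighten.

(** * Green polynomials *)

Lemma tX_neq1 k : (0 < k)%N -> 1 - t ^+ k != 0.
Proof.
move=> k0; rewrite /t -tofracXn -tofrac1 -tofracB tofrac_eq0 subr_eq0.
apply/eqP => /(congr1 (fun p : {poly rat} => p`_k)).
by rewrite coefXn coef1 eqxx; case: k k0.
Qed.

Lemma natrQt_neq0 k : (0 < k)%N -> (k%:R : Qt) != 0.
Proof.
move=> k0; rewrite -tofracMn tofrac_eq0 -polyC1 -polyCMn polyC_eq0.
by rewrite pnatr_eq0 -lt0n.
Qed.

Lemma qsymE n :
  qsym n = @exp_coef Qt V (fun k => ((1 - t ^+ k) / k%:R) *: psum k) n.
Proof. reflexivity. Qed.

Lemma qsym0 : qsym 0 = 1.
Proof. by rewrite qsymE exp_coef0. Qed.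

Lemma qsym_newton n : n%:R *: qsym n =
  \sum_(1 <= k < n.+1) (1 - t ^+ k) *: (psum k * qsym (n - k)).
Proof.
rewrite qsymE (exp_coef_newton natrQt_neq0).
apply: eq_big_nat => k /andP[k0 _].
by rewrite -scalerAl scalerA mulrC divfK ?natrQt_neq0.
Qed.

Notation Hl := (@HLtuple Qt V psum (@psubst Qt) qsym).
Notation Hp := (@HLpart Qt V psum (@psubst Qt) qsym).
Notation pairing := (@hall Qt t).

Lemma HLQ_vertex la : HLQ la = Hp la.
Proof.
have E := @HLpart_fsum Qt t V natrQt_neq0 tX_neq1 psum (@psum_ind Qt) (@psubst Qt)
  (@psubst_psum Qt) (@psubstZ Qt) qsym qsym0 qsym_newton la.
apply/esym; apply: etrans E _.
reflexivity.
Qed.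

Lemma HLbE la : HLb la = HLnorm t la.
Proof.
elim: la => [|m la IHla] /=; first by rewrite /HLb big_nil.
rewrite -IHla /HLb [undup (m :: la)]/=; case: ifP => mla.
- rewrite (bigD1_seq m) ?mem_undup ?undup_uniq //=.
  rewrite [in RHS](bigD1_seq m) ?mem_undup ?undup_uniq //=.
  rewrite eqxx add1n big_nat_recr //= mulrA [_ * (1 - _)]mulrC; congr (_ * _).
  by apply: eq_bigr => i im; rewrite eq_sym (negPf im).
have c1 : ((m == m) + count_mem m la = 1)%N.
  by rewrite eqxx (count_memPn _) // mla.
rewrite big_cons /= c1 big_nat1; congr (_ * _).
rewrite big_seq [RHS]big_seq; apply: eq_bigr => i.
rewrite mem_undup => ila; case: eqP => [E|] //; by rewrite E ila in mla.
Qed.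

Lemma psum_part_monom mu : 0%N \notin mu -> exists m, psum_part mu = @monom Qt m.
Proof.
rewrite /psum_part; elim: mu => [_|[|k] mu IHmu]; rewrite ?inE //.
  by exists mone; rewrite big_nil monom1.
move=> /IHmu[m E]; exists (mmul (ucm k) m).
by rewrite big_cons E -psumM_monom.
Qed.

(** p_mu is a monomial, and its own coefficient is 1. *)
Lemma psum_part_neq0 mu : 0%N \notin mu -> psum_part mu != 0.
Proof.
move=> /psum_part_monom[m ->]; apply/eqP => E.
have := pcoef_monom Qt m m; rewrite E eqxx -(scale0r 1) pcoefZ mul0r.
by move/eqP; rewrite eq_sym oner_eq0.
Qed.

Lemma green_pairing X : is_green X -> forall la mu,
  is_partition la -> is_partition mu -> X la mu = pairing (Hp la) (psum_part mu).
Proof.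
move=> hX la mu hla hmu; have /andP[_ mu0] := hmu.
apply: (@hall_coordinates Qt t V natrQt_neq0 tX_neq1 psum (@psum_ind Qt) (@psubst Qt)
  (@psubst_psum Qt) (@psubstZ Qt) qsym qsym0 qsym_newton pairing
  (@hallD Qt t) (@hallZ Qt t) (@hallC Qt t) (@hall11 Qt t) (@hall_psum Qt t)
  (X^~ mu) (psum_part mu) (psum_part_neq0 mu0) _ la hla).
apply: etrans (hX mu hmu) _; apply: eq_fsbigr => nu _.
by rewrite /HLP HLbE HLQ_vertex.
Qed.

Lemma sub_epsE la m j : sub_eps la m j = sub_at m%:Z j (map Posz la).
Proof.
rewrite /sub_eps /sub_at /mkseq size_map; apply/eq_in_map => i.
by rewrite mem_iota => /andP[_ ila]; rewrite (nth_map 0%N).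
Qed.

Lemma pairing_straighten f al i : ascent al i ->
  pairing (Hl al) f =
  \sum_(a < (gap al i)./2.+1) Sop_coef (i, val a) al * pairing (Hl (Sop (i, val a) al)) f.
Proof.
move=> asc; have [u [x [y [v [Eal _ ltxy gapE SopE]]]]] := ascentP asc.
rewrite {1}Eal (@HLtuple_straighten Qt t V natrQt_neq0 tX_neq1 psum (@psum_ind Qt)
  (@psubst Qt) (@psubst_psum Qt) (@psubstZ Qt) qsym qsym0 qsym_newton) //.
rewrite (@hall_sum Qt V pairing (@hallD Qt t) (@hallZ Qt t)) gapE.
apply: eq_bigr => a _; rewrite hallZ SopE; congr (_ * _).
by rewrite -[RHS]/(straight_coef t (gap al i) (val a)) gapE.
Qed.

Lemma weakly_decreasing_neg al : weakly_decreasing al ->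
  ~~ all (fun x => 0 <= x) al -> Hl al = 0.
Proof.
case/lastP: al => // al x; rewrite /weakly_decreasing => wd neg.
apply: (HLtuple_rcons_neg _ (@psubstZ Qt)); rewrite ltNge; apply: contra neg => x0.
rewrite all_rcons x0 /=; apply/allP => y yal; apply: le_trans x0 _.
move: wd; rewrite sorted_pairwise => [|u v w uv vw]; last exact: le_trans vw uv.
by rewrite pairwise_rcons => /andP[/allP/(_ y yal)].
Qed.

Lemma parts_of_partition al : weakly_decreasing al ->
  all (fun x => 0 <= x) al -> is_partition (parts_of al).
Proof.
move=> wd ge0; apply/andP; split; last first.
  apply/mapP => -[x]; rewrite mem_filter => /andP[x0 _] /esym/eqP.
  by rewrite absz_eq0 (negPf x0).
rewrite /parts_of sorted_map.
apply: (@sub_in_sorted _ (fun x => 0 <= x) (fun x y => y <= x)).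
- by move=> x y; rewrite !unfold_in => x0 y0 yx /=; lia.
- by apply/allP => x; rewrite mem_filter => /andP[_ /(allP ge0)].
apply: sorted_filter wd => u v w uv vw; exact: le_trans vw uv.
Qed.

Theorem theorem3p2 (X : seq nat -> seq nat -> Qt) (hX : is_green X)
    (sel : seq int -> nat) (hsel : straightening_rule sel)
    (n : nat) (hn : (0 < n)%N) (la mu : seq nat)
    (hla : is_partition_of n la) (hmu : is_partition_of n mu) :
  X la mu =
  \sum_(j < size la)
    \sum_(s \in [set s : seq (nat * nat) |
                  Sseq_follows sel s (sub_eps la (head 0%N mu) j) /\
                  tuple_partition_of (n%:Z - (head 0%N mu)%:Z)
                    (Sseq s (sub_eps la (head 0%N mu) j))])
      Sseq_coef s (sub_eps la (head 0%N mu) j) *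
      X (parts_of (Sseq s (sub_eps la (head 0%N mu) j))) (behead mu).
Proof.
have /andP[la_part /eqP sum_la] := hla; have /andP[mu_part /eqP sum_mu] := hmu.
rewrite (green_pairing hX la_part mu_part).
case: mu mu_part sum_mu {hmu} => [_ n0|m mu mu_part _]; first by rewrite -n0 in hn.
rewrite [head _ _]/= [behead _]/=.
have m0 : (0 < m)%N.
  by have /andP[_] := mu_part; rewrite inE negb_or eq_sym -lt0n => /andP[].
have mu'_part : is_partition mu.
  have /andP[/= /path_sorted smu] := mu_part.
  by rewrite inE negb_or => /andP[_ mu0]; apply/andP.
have -> : psum_part (m :: mu) = psum m * psum_part mu by rewrite /psum_part big_cons.
rewrite (@hall_pM_HLpart Qt t V natrQt_neq0 tX_neq1 psum (@psum_ind Qt)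
  (@psubst Qt) (@psubst_psum Qt) (@psubstZ Qt) qsym qsym0 qsym_newton pairing
  (@hallD Qt t) (@hallZ Qt t) (@hallC Qt t) (@hall_psum Qt t)) //.
apply: eq_bigr => j _; rewrite sub_epsE.
have sum_al : \sum_(x <- sub_at m%:Z j (map Posz la)) x = n%:Z - m%:Z.
  rewrite sum_sub_at ?size_map ?ltn_ord // big_map -sum_la sumnE.
  by rewrite (big_morph Posz PoszD (erefl : Posz 0 = 0)).
rewrite (@straighten_fsum sel (fun al => pairing (Hl al) (psum_part mu)) hsel
  (pairing_straighten _) _ _ _ sum_al) //; last first.
  move=> al wd neg; rewrite weakly_decreasing_neg //.
  exact: (@hall0 Qt V pairing (@hallZ Qt t)).
apply: eq_fsbigr => s; rewrite inE => -[_ /and3P[wd ge0 _]].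
congr (_ * _); rewrite (green_pairing hX) //; last exact: parts_of_partition.
by rewrite (HLtuple_parts _ _ qsym0).
Qed.
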